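(* Let $\alpha>0$ and let $\ell\ge\lfloor\alpha\rfloor$ be an integer, where $\lfloor\alpha\rfloor$ denotes the largest integer not larger than $\alpha$. Suppose that $s_1,\ldots,s_\ell$ are $\ell$ distinct (complex) numbers located outside $(-\infty,0]$. Then for all $z\in\mathbb C\setminus(-\infty,0)$, $$z^{\alpha}=\frac{\sin(\alpha\pi)}{(-1)^{\ell}\pi}\int_0^{+\infty}\frac{zy^{\alpha-1}}{y+z}\left(\prod_{k=1}^{\ell}\frac{z-s_k}{y+s_k}\right)\mathrm dy+z\,\mathcal L[z^{\alpha-1};s_1,\ldots,s_\ell],$$ $$z^{\alpha}\log z=\frac{\sin(\alpha\pi)}{(-1)^\ell\pi}\int_{0}^{+\infty}\frac{zy^{\alpha-1}\log y}{y+z}\left(\prod_{k=1}^{\ell}\frac{z-s_k}{y+s_k}\right)\mathrm dy+\frac{\cos(\alpha\pi)}{(-1)^{\ell}}\int_0^{+\infty}\frac{zy^{\alpha-1}}{y+z}\left(\prod_{k=1}^{\ell}\frac{z-s_k}{y+s_k}\right)\mathrm dy+z\,\mathcal L[z^{\alpha-1}\log z;s_1,\ldots,s_\ell].$$ Especially, for $0<\alpha<1$, $$z^{\alpha}=\frac{\sin(\alpha\pi)}{\pi}\int_0^{+\infty}\frac{zy^{\alpha-1}}{y+z}\mathrm dy,\qquad z^{\alpha}\log z=\frac{\sin(\alpha\pi)}{\pi}\int_{0}^{+\infty}\frac{zy^{\alpha-1}\log y}{y+z}\mathrm dy+\cos(\alpha\pi)\int_{0}^{+\infty}\frac{zy^{\alpha-1}}{y+z}\mathrm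 dy.$$
   Context: $\mathcal L[X(z);s_1,\ldots,s_\ell]$ denotes the Lagrange interpolating polynomial in $z$ (of degree at most $\ell-1$) of the function $X$ at the nodes $s_1,\ldots,s_\ell$, i.e. $\sum_{l=1}^{\ell}X(s_l)\prod_{k\neq l}\frac{z-s_k}{s_l-s_k}$, here with $X(z)=z^{\alpha-1}$ or $X(z)=z^{\alpha-1}\log z$; for $\ell=0$ it is $0$ and empty products equal $1$. $z^\alpha$ and $\log z$ are principal branches on $\mathbb C\setminus(-\infty,0]$. At $z=0$, the values $z^\alpha$, $z^\alpha\log z$ and the integrands (which carry the factor $z$) are taken to be $0$. *)

(* Defs.v *)
From mathcomp Require Import all_boot all_order all_algebra.
From mathcomp Require Import complex.
From mathcomp Require Import all_classical all_reals all_analysis.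

Set Implicit Arguments.
Unset Strict Implicit.
Unset Printing Implicit Defensive.

Import Order.TTheory GRing.Theory Num.Theory.
Import numFieldNormedType.Exports.

Local Open Scope classical_set_scope.
Local Open Scope ring_scope.
Local Open Scope complex_scope.

(* Principal argument, in ]-pi, pi] for z != 0. *)
Definition carg (R : realType) (z : R[i]) : R :=
  if 0 <= complex.Im z then acos (complex.Re z / Normc.normc z)
  else - acos (complex.Re z / Normc.normc z).

Definition cexp (R : realType) (z : R[i]) : R[i] :=
  (expR (complex.Re z))%:C * (cos (complex.Im z) +i* sin (complex.Im z)).

Definition clog (R : realType) (z : R[i]) : R[i] := ln (Normc.normc z) +i* carg z.

(* The value 0 at z = 0 is the convention for a > 0; for other exponents it is
   never used, since the base is then a node outside ]-oo, 0]. *)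
Definition cpow (R : realType) (z : R[i]) (a : R) : R[i] :=
  if z == 0 then 0 else cexp (a%:C * clog z).

Definition lagrange_interp (R : realType) (l : nat) (X : R[i] -> R[i])
    (s : 'I_l -> R[i]) (z : R[i]) : R[i] :=
  \sum_(i < l) X (s i) * \prod_(k < l | k != i) ((z - s k) / (s i - s k)).

(* Lebesgue integrals over ]0, +oo[ of complex-valued functions, taken
   componentwise. *)
Definition cintegrable (R : realType) (f : R -> R[i]) : Prop :=
  (@lebesgue_measure R).-integrable `]0, +oo[%classic
    (fun y => (complex.Re (f y))%:E) /\
  (@lebesgue_measure R).-integrable `]0, +oo[%classic
    (fun y => (complex.Im (f y))%:E).

Definition cintegral (R : realType) (f : R -> R[i]) : R[i] :=
  (\int[@lebesgue_measure R]_(y in `]0, +oo[) complex.Re (f y)) +i*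
  (\int[@lebesgue_measure R]_(y in `]0, +oo[) complex.Im (f y)).

Definition pow_kernel (R : realType) (a : R) (z : R[i]) (y : R) : R[i] :=
  z * (y `^ (a - 1))%:C / (y%:C + z).

Definition log_kernel (R : realType) (a : R) (z : R[i]) (y : R) : R[i] :=
  z * (y `^ (a - 1))%:C * (ln y)%:C / (y%:C + z).

Definition node_prod (R : realType) (l : nat) (s : 'I_l -> R[i]) (z : R[i])
    (y : R) : R[i] :=
  \prod_(k < l) ((z - s k) / (y%:C + s k)).

(* Main.v *)
Require Import Defs.
From mathcomp Require Import all_boot all_order all_algebra.
From mathcomp Require Import complex ring lra.
From mathcomp Require Import all_classical all_reals all_analysis.
From mathcomp Require Import measurable_realfun.

Set Implicit Arguments.
Unset Strict Implicit.
Unset Printing Implicit Defensive.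

Import Order.TTheory GRing.Theory Num.Theory.
Import numFieldNormedType.Exports.

Local Open Scope classical_set_scope.
Local Open Scope ring_scope.
Local Open Scope complex_scope.

Local Notation leb := (@lebesgue_measure _).
Local Notation halfline := (`]0%R, +oo[%classic).
Local Notation negreals R := [set x%:C | x in `]-oo, (0 : R)]].

(** The rational factor of the integrands splits into simple fractions with poles
    at [- z] and at the opposites of the nodes, and the proof reduces to the
    classical evaluation of one Stieltjes transform,

      int_0^oo y^(b-1) / (y + w) dy = pi / sin(b pi) * w^(b-1)

    for [0 < b < 1] and [w] outside the closed negative half-line
    ([stieltjes_transform]).

    This evaluation is obtained with real variables only. Let [w = r e^(i t)]. The
    derivative in [t] of [e^(i (1-b) t) y^(b-1) / (y + w)] is an exact derivative
    in [y] of a function vanishing at 0 and at infinity, so the integral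
    of the rotated kernel does not depend on [t] ([rot_integral_cst]). Hence its
    value at [w] is [e^(- i (1-b) t)] times a constant depending on [r]. When [t]
    tends to [pi], the imaginary part of the kernel becomes a point mass [pi] at
    [y = r], up to sign, and this determines the constant ([stieltjes_cst_sin]).

    Let now [a = n + b] with [n] an integer at most [l] and [0 < b < 1]. The
    product of [1 / (y + z)] by the factors [(z - s_k) / (y + s_k)] is, up to the
    sign [(-1)^l], the error committed when [w |-> 1 / (y + w)] is interpolated at
    the nodes. Moreover [y^n / (y + w)] and [(- w)^n / (y + w)] differ by a
    polynomial of degree less than [n <= l] in [w], which interpolation reproduces.
    So [y^n] times the product is the interpolation error of
    [w |-> (- w)^n / (y + w)] ([lagrange_pole]), and integrating against [y^(b-1)]
    yields [pi / sin(a pi)] times the interpolation error of [w |-> w^(a-1)]. This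
    is the first formula; for an integer [a] it says that interpolation reproduces
    [w^(a-1)] ([interp_formula]).

    The second formula is the derivative of the first one with respect to [a],
    over the open interval from 0 to [l + 1]. Differentiation under the integral
    sign is licensed by [is_derive_Mellin], as the integrand is [y^(a-1)] times a
    function that is [O((1 + y)^(- l - 1))]. *)

(** * Improper integrals over the open half-line *)

Lemma cvg_harmonicD1 (R : realType) : (n.+1%:R : R)^-1 @[n --> \oo] --> (0:R).
Proof. exact: cvg_harmonic. Qed.

Lemma derivable_measurable_0y (R : realType) (f : R -> R) :
  (forall y : R, 0 < y -> derivable f y 1) ->
  measurable_fun (halfline : set R) f.
Proof.
move=> df; apply: open_continuous_measurable_fun; first exact: interval_open.
move=> y; rewrite inE/= in_itv/= andbT => y0.
by apply: differentiable_continuous; apply/derivable1_diffP; exact: df.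
Qed.

(** Compact intervals increasing to the open half-line: the integrands met below
    are in general singular at 0, so both ends have to be approached. *)
Definition exhaust (R : realType) (n : nat) : set R :=
  `[n.+2%:R^-1, n.+2%:R]%classic.

Lemma exhaustE (R : realType) (n : nat) (y : R) :
  @exhaust R n y <-> n.+2%:R^-1 <= y <= n.+2%:R.
Proof. by rewrite /exhaust/= in_itv. Qed.

Lemma exhaust_sub (R : realType) (n : nat) (y : R) : @exhaust R n y -> 0 < y.
Proof. by move=> /exhaustE/andP[+ _]; apply: lt_le_trans; rewrite invr_gt0. Qed.

Lemma near_exhaust (R : realType) (y : R) : 0 < y ->
  \forall n \near \oo, @exhaust R n y.
Proof.
move=> y0; near=> n; apply/exhaustE.
have h : n%:R <= n.+2%:R :> R by rewrite ler_nat ltnW.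
apply/andP; split.
  rewrite invf_ple ?posrE//; apply: le_trans h.
  by near: n; exact: nbhs_infty_ger.
by apply: le_trans h; near: n; exact: nbhs_infty_ger.
Unshelve. all: end_near. Qed.

Lemma exhaust_nd (R : realType) (m n : nat) (y : R) : (m <= n)%N ->
  @exhaust R m y -> @exhaust R n y.
Proof.
move=> mn /exhaustE/andP[a b]; apply/exhaustE; apply/andP; split.
  by apply: le_trans a; rewrite lef_pV2 ?posrE// ler_nat.
by apply: (le_trans b); rewrite ler_nat.
Qed.

(** The integral of [f] cut off outside [exhaust n] is an integral over a
    segment, where the fundamental theorem of calculus applies; the two improper
    forms below only differ in how the cut-off is removed. *)
Lemma cvg_integral_exhaust (R : realType) (f F : R -> R) (A B : R) :
  (forall y : R, 0 < y -> is_derive y 1 F (f y)) ->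
  (forall y : R, 0 < y -> derivable f y 1) ->
  F x @[x --> 0^'+] --> A -> F x @[x --> +oo] --> B ->
  (\int[leb]_(y in halfline)
     ((fun y => (f y)%:E) \_ (@exhaust R n)) y)%E @[n --> \oo] --> (B - A)%:E.
Proof.
move=> dF df FA FB.
have E n : (\int[leb]_(y in halfline)
     ((fun y => (f y)%:E) \_ (@exhaust R n)) y)%E = (F n.+2%:R - F n.+2%:R^-1)%:E.
  rewrite -integral_mkcondr setIidr; last first.
    by move=> y /exhaust_sub; rewrite /= in_itv/= andbT.
  have n0 : 0 < n.+2%:R^-1 :> R by rewrite invr_gt0.
  have n1 : n.+2%:R^-1 < n.+2%:R :> R.
    by apply: (@lt_trans _ _ 1); rewrite ?invf_lt1// ltr1n.
  rewrite (@continuous_FTC2 _ f F)//.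
  - apply: derivable_within_continuous => y; rewrite in_itv/= => /andP[h _].
    by apply: df; apply: lt_le_trans h.
  - have cF (y : R) : 0 < y -> F @ y --> F y.
      move=> y0; apply: differentiable_continuous; apply/derivable1_diffP.
      by apply: ex_derive; exact: dF.
    split.
    + move=> y; rewrite in_itv/= => /andP[h _].
      by apply: ex_derive; apply: dF; apply: lt_trans h.
    + by apply: cvg_at_right_filter; exact: cF.
    + by apply: cvg_at_left_filter; apply: cF; rewrite ltr0n.
  - move=> y; rewrite in_itv/= => /andP[h _]; rewrite derive1E.
    have y0 := lt_trans n0 h.
    by have := dF _ y0 => ?; rewrite derive_val.
rewrite (eq_cvg _ _ E); apply: cvg_EFin; first exact: nearW.
apply: cvgB.
  apply: (cvg_comp (fun n : nat => n.+2%:R : R) F) FB.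
  apply/cvgryPge => M; near=> n.
  apply: (@le_trans _ _ n%:R); last by rewrite ler_nat ltnW.
  by near: n; exact: nbhs_infty_ger.
move/cvg_at_rightP : FA; apply; split; first by move=> n; rewrite invr_gt0.
have := @cvg_harmonicD1 R; rewrite -(cvg_shiftS (fun n : nat => n.+1%:R^-1 : R)).
exact.
Unshelve. all: end_near. Qed.

(** For a nonnegative integrand the cut-offs increase, and monotone convergence
    removes them without assuming integrability beforehand. *)
Lemma ge0_FTC_0y (R : realType) (f F : R -> R) (A B : R) :
  (forall y : R, 0 < y -> is_derive y 1 F (f y)) ->
  (forall y : R, 0 < y -> derivable f y 1) ->
  (forall y : R, 0 < y -> 0 <= f y) ->
  F x @[x --> 0^'+] --> A -> F x @[x --> +oo] --> B ->
  (\int[leb]_(y in halfline) (f y)%:E)%E = (B - A)%:E.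
Proof.
move=> dF df f0 FA FB.
have cE := cvg_integral_exhaust dF df FA FB.
apply/esym/(cvg_unique _ cE) => //=.
have mf := derivable_measurable_0y df.
have mD : measurable (halfline : set R) by exact: measurable_itv.
rewrite [X in _ --> X](_ : _ = (\int[leb]_(y in halfline)
     limn (fun n => ((fun y => (f y)%:E) \_ (@exhaust R n)) y))%E); last first.
  apply: eq_integral => y; rewrite inE/= in_itv/= andbT => y0.
  apply/esym/cvg_lim => //; apply: cvg_near_cst.
  have := near_exhaust y0; apply: filterS => n h.
  by rewrite patchE mem_set.
apply: cvg_monotone_convergence => //.
- move=> n; apply/measurable_restrict => //; first exact: measurable_itv.
  by apply/measurable_EFinP; apply: measurable_funS mf => //; exact: subIsetl.
- move=> n y; rewrite /= in_itv/= andbT patchE => y0.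
  by case: ifP => // _; rewrite lee_fin f0.
- move=> y; rewrite /= in_itv/= andbT => y0 m n mn; rewrite !patchE.
  case: ifPn => [|_].
    by rewrite inE => /(exhaust_nd mn)/mem_set ->.
  by case: ifP => // _; rewrite lee_fin f0.
Qed.

Lemma ge0_FTC_0y_integrable (R : realType) (f F : R -> R) (A B : R) :
  (forall y : R, 0 < y -> is_derive y 1 F (f y)) ->
  (forall y : R, 0 < y -> derivable f y 1) ->
  (forall y : R, 0 < y -> 0 <= f y) ->
  F x @[x --> 0^'+] --> A -> F x @[x --> +oo] --> B ->
  leb.-integrable halfline (EFin \o f).
Proof.
move=> dF df f0 FA FB; apply/integrableP; split.
  by apply/measurable_EFinP; exact: derivable_measurable_0y.
rewrite (_ : (\int[_]_(x in _) _ )%E = (B - A)%:E) ?ltry//.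
rewrite -(ge0_FTC_0y dF df f0 FA FB); apply: eq_integral => y.
by rewrite inE/= in_itv/= andbT => y0; rewrite ger0_norm// f0.
Qed.

(** For an integrand of arbitrary sign, dominated convergence by the integrand
    itself removes the cut-offs. *)
Lemma FTC_0y (R : realType) (f F : R -> R) (A B : R) :
  (forall y : R, 0 < y -> is_derive y 1 F (f y)) ->
  (forall y : R, 0 < y -> derivable f y 1) ->
  leb.-integrable halfline (EFin \o f) ->
  F x @[x --> 0^'+] --> A -> F x @[x --> +oo] --> B ->
  (\int[leb]_(y in halfline) f y) = B - A.
Proof.
move=> dF df intf FA FB.
have cE := cvg_integral_exhaust dF df FA FB.
suff: (\int[leb]_(y in halfline) (f y)%:E)%E = (B - A)%:E.
  by move=> h; rewrite /Rintegral h.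
apply/esym/(cvg_unique _ cE) => //=.
have mf := derivable_measurable_0y df.
have mD : measurable (halfline : set R) by exact: measurable_itv.
apply: (@dominated_cvg _ _ _ leb _ mD _ _ (fun y => `|f y|%:E)) => //.
- move=> n; apply/measurable_restrict => //; first exact: measurable_itv.
  by apply/measurable_EFinP; apply: measurable_funS mf => //; exact: subIsetl.
- move=> y; rewrite /= in_itv/= andbT => y0; apply: cvg_near_cst.
  have := near_exhaust y0; apply: filterS => n h.
  by rewrite patchE mem_set.
- exact: integrable_norm.
- move=> n y _; rewrite patchE; case: ifP => // _.
  by rewrite abse0 lee_fin.
Qed.

(** * Computing derivatives *)

Lemma is_derive1D (R : realType) (f g : R -> R) (x a b : R) :
  is_derive x 1 f a -> is_derive x 1 g b ->
  is_derive x 1 (fun y => f y + g y) (a + b).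
Proof. by move=> df dg; apply: is_deriveD. Qed.

Lemma is_derive1N (R : realType) (f : R -> R) (x a : R) :
  is_derive x 1 f a -> is_derive x 1 (fun y => - f y) (- a).
Proof. by move=> df; apply: is_deriveN. Qed.

Lemma is_derive1M (R : realType) (f g : R -> R) (x a b : R) :
  is_derive x 1 f a -> is_derive x 1 g b ->
  is_derive x 1 (fun y => f y * g y) (a * g x + f x * b).
Proof.
move=> df dg; apply: (is_derive_eq (is_deriveM df dg)).
by rewrite /GRing.scale/=; ring.
Qed.

Lemma is_derive1V (R : realType) (f : R -> R) (x a : R) : f x != 0 ->
  is_derive x 1 f a -> is_derive x 1 (fun y => (f y)^-1) (- a / f x ^+ 2).
Proof.
move=> f0 df; apply: (is_derive_eq (is_deriveV f0 df)).
by rewrite /GRing.scale/= mulNr mulNr mulrC.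
Qed.

Lemma is_derive1X (R : realType) (f : R -> R) (n : nat) (x a : R) :
  is_derive x 1 f a ->
  is_derive x 1 (fun y => f y ^+ n) (n%:R * f x ^+ n.-1 * a).
Proof.
move=> df; have -> : (fun y => f y ^+ n) = f ^+ n.
  by apply/funext => y; rewrite exprfctE.
apply: (is_derive_eq (is_deriveX n df)).
by rewrite /GRing.scale/= mulr_natl.
Qed.

Lemma is_derive1_cst (R : realType) (c x : R) : is_derive x 1 (fun=> c) 0.
Proof. exact: is_derive_cst. Qed.

Lemma is_derive1_id (R : realType) (x : R) : is_derive x 1 (fun y : R => y) 1.
Proof. exact: is_derive_id. Qed.

Lemma is_derive1_cos (R : realType) (f : R -> R) (x a : R) :
  is_derive x 1 f a -> is_derive x 1 (fun y => cos (f y)) (- sin (f x) * a).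
Proof. by move=> df; apply: (is_derive1_comp (is_derive_cos _) df). Qed.

Lemma is_derive1_sin (R : realType) (f : R -> R) (x a : R) :
  is_derive x 1 f a -> is_derive x 1 (fun y => sin (f y)) (cos (f x) * a).
Proof. by move=> df; apply: (is_derive1_comp (is_derive_sin _) df). Qed.

Lemma is_derive1_exp (R : realType) (f : R -> R) (x a : R) :
  is_derive x 1 f a -> is_derive x 1 (fun y => expR (f y)) (expR (f x) * a).
Proof. by move=> df; apply: (is_derive1_comp (is_derive_expR _) df). Qed.

Ltac derive_step :=
  lazymatch goal with
  | |- is_derive _ _ (fun=> ?c) _ => eapply is_derive1_cst
  | |- is_derive _ _ (fun y => y) _ => eapply is_derive1_id
  | |- is_derive _ _ (fun y => - @?f y) _ => eapply (@is_derive1N _ f)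
  | |- is_derive _ _ (fun y => @?f y + @?g y) _ =>
      eapply (@is_derive1D _ f g)
  | |- is_derive _ _ (fun y => (@?f y)^-1) _ => eapply (@is_derive1V _ f)
  | |- is_derive _ _ (fun y => (@?f y) ^+ _) _ => eapply (@is_derive1X _ f)
  | |- is_derive _ _ (fun y => @?f y * @?g y) _ =>
      eapply (@is_derive1M _ f g)
  | |- is_derive _ _ (fun y => cos (@?f y)) _ => eapply (@is_derive1_cos _ f)
  | |- is_derive _ _ (fun y => sin (@?f y)) _ => eapply (@is_derive1_sin _ f)
  | |- is_derive _ _ (fun y => expR (@?f y)) _ => eapply (@is_derive1_exp _ f)
  | |- is_derive _ _ (fun y => y `^ _) _ => eapply is_derive1_powR
  | |- is_derive _ _ ln _ => eapply is_derive1_ln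
  | |- is_derive _ _ _ _ => eassumption
  | |- is_true _ => cbv beta; match goal with H : ?P |- ?P => exact H end
  end.
(** [derive] replaces the announced derivative by the one computed from the
    structure of the function and leaves the equality of the two; [derivable]
    leaves the denominators to be shown nonzero. *)
Ltac derive := eapply is_derive_eq; [by repeat derive_step|].

Lemma is_derive1_derivable (R : realType) (f : R -> R) (x a : R) :
  is_derive x 1 f a -> derivable f x 1.
Proof. by case. Qed.

Ltac derivable := eapply is_derive1_derivable; repeat derive_step; cbv beta.

(** * Integrability of powers and logarithms *)

Lemma powRD_gt0 (R : realType) (y p q : R) : 0 < y ->
  y `^ (p + q) = y `^ p * y `^ q.
Proof. by move=> y0; apply: powRD; rewrite (gt_eqF y0) implybT. Qed.

Lemma powRN_cvgy0 (R : realType) (e : R) : 0 < e ->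
  x `^ (- e) @[x --> +oo] --> (0 : R).
Proof.
move=> e0; apply/cvgrPdist_lt => eps eps0; near=> x.
have x0 : 0 < x by near: x; exact: nbhs_pinfty_gt.
rewrite sub0r normrN ger0_norm ?powR_ge0// powRN invf_plt ?posrE ?powR_gt0//.
have -> : eps^-1 = (eps^-1 `^ e^-1) `^ e.
  by rewrite -powRrM mulVf ?gt_eqF// powRr1// invr_ge0 ltW.
rewrite gt0_ltr_powR// ?nnegrE ?powR_ge0 ?ltW//.
Unshelve. all: end_near. Qed.

Lemma integrable_dominated (R : realType) (f g : R -> R) :
  measurable_fun (halfline : set R) f ->
  (forall y : R, 0 < y -> `|f y| <= g y) ->
  leb.-integrable halfline (EFin \o g) ->
  leb.-integrable halfline (EFin \o f).
Proof.
move=> mf fg; apply: le_integrable => //; first exact/measurable_EFinP.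
move=> y; rewrite /= in_itv/= andbT => y0; rewrite lee_fin.
by rewrite (le_trans (fg _ y0))// ler_norm.
Qed.

Lemma integrable_halflineZl (R : realType) (k : R) (f : R -> R) :
  leb.-integrable halfline (EFin \o f) ->
  leb.-integrable halfline (EFin \o (fun y => k * f y)).
Proof.
move=> fi; have := @integrableZl _ _ R leb halfline (measurable_itv _) k _ fi.
by apply: eq_integrable => //; exact: measurable_itv.
Qed.

Lemma integrable_halflineD (R : realType) (f g : R -> R) :
  leb.-integrable halfline (EFin \o f) ->
  leb.-integrable halfline (EFin \o g) ->
  leb.-integrable halfline (EFin \o (fun y => f y + g y)).
Proof.
move=> fi gi; have := @integrableD _ _ R leb halfline (measurable_itv _) _ _ fi gi.
by apply: eq_integrable => //; exact: measurable_itv.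
Qed.

Lemma Rintegral_halflineZl (R : realType) (k : R) (f : R -> R) :
  leb.-integrable halfline (EFin \o f) ->
  \int[leb]_(y in halfline) (k * f y) = k * \int[leb]_(y in halfline) f y.
Proof. exact: (@RintegralZl _ _ R leb halfline f k (measurable_itv _)). Qed.

Lemma Rintegral_halflineD (R : realType) (f g : R -> R) :
  leb.-integrable halfline (EFin \o f) ->
  leb.-integrable halfline (EFin \o g) ->
  \int[leb]_(y in halfline) (f y + g y) =
  \int[leb]_(y in halfline) f y + \int[leb]_(y in halfline) g y.
Proof. exact: (@RintegralD _ _ R leb halfline f g (measurable_itv _)). Qed.

(** This function is the derivative of [- e^-1 * (1 + y `^ e)^-1], a bounded
    monotone function. It behaves like [y `^ (e - 1)] at 0 and like
    [y `^ (- e - 1)] at infinity, hence for [e] at most [a] and [m - a] it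
    dominates [y `^ (a - 1) / (1 + y) ^+ m] up to a constant. *)
Lemma integrable_powR_majorant (R : realType) (e : R) : 0 < e ->
  leb.-integrable halfline
    (EFin \o (fun y => y `^ (e - 1) / (1 + y `^ e) ^+ 2)).
Proof.
move=> e0.
have p0 (y : R) : 0 < 1 + y `^ e by rewrite ltr_pwDl// powR_ge0.
have dp (y : R) : 0 < y -> is_derive y 1 (fun y => 1 + y `^ e) (e * y `^ (e - 1)).
  by move=> y0; derive; rewrite add0r.
apply: (@ge0_FTC_0y_integrable R (fun y => y `^ (e - 1) / (1 + y `^ e) ^+ 2)
  (fun y => - e^-1 * (1 + y `^ e)^-1) (- e^-1) 0).
- move=> y y0; have n0 : 1 + y `^ e != 0 by rewrite gt_eqF.
  derive.
  rewrite mul0r !add0r.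
  by field; rewrite n0 gt_eqF.
- move=> y y0; have dp' := dp y y0; derivable.
  by rewrite expf_neq0// gt_eqF.
- by move=> y _; rewrite divr_ge0// ?powR_ge0// exprn_ge0// ltW.
- have c1 : (1 + y `^ e) @[y --> 0^'+] --> 1 + (0 : R).
    apply: cvgD; [exact: cvg_cst|exact: powR_cvg0].
  have c2 : (1 + y `^ e)^-1 @[y --> 0^'+] --> (1 + (0 : R))^-1.
    by apply: cvgV c1; rewrite addr0 oner_neq0.
  by have := cvgM (cvg_cst (- e^-1)) c2; rewrite addr0 invr1 mulr1; apply.
- have c1 : (1 + y `^ e)^-1 @[y --> +oo] --> (0 : R).
    apply: (@squeeze_cvgr _ _ _ _ (fun=> 0) (fun x => x `^ (- e))).
    + near=> x; have x0 : 0 < x by near: x; exact: nbhs_pinfty_gt.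
      rewrite invr_ge0 ltW//= powRN lef_pV2 ?posrE ?powR_gt0//.
      by rewrite lerDr.
    + exact: cvg_cst.
    + exact: powRN_cvgy0.
  by have := cvgM (cvg_cst (- e^-1)) c1; rewrite mulr0; apply.
Unshelve. all: end_near. Qed.

Lemma measurable_powR0y (R : realType) (p : R) :
  measurable_fun (halfline : set R) (fun y => y `^ p).
Proof. by apply: measurable_funTS; exact: measurable_powR. Qed.

Lemma measurable_invXn (R : realType) (m : nat) :
  measurable_fun (halfline : set R) (fun y => ((1 + y) ^+ m)^-1).
Proof.
apply: derivable_measurable_0y => y y0; derivable.
by rewrite expf_neq0// gt_eqF// addr_gt0.
Qed.

Lemma integrable_powR_div (R : realType) (a : R) (m : nat) : 0 < a < m%:R ->
  leb.-integrable halfline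
    (EFin \o (fun y => y `^ (a - 1) / (1 + y) ^+ m)).
Proof.
move=> /andP[a0 am]; pose e := Num.min a (m%:R - a).
have e0 : 0 < e by rewrite lt_min a0 subr_gt0.
have ea : e <= a by rewrite ge_min lexx.
have em : a + e <= m%:R by rewrite addrC -lerBrDr ge_min lexx orbT.
apply: (@integrable_dominated _ _
  (fun y => 4 * (y `^ (e - 1) / (1 + y `^ e) ^+ 2))).
- by apply: measurable_funM; [exact: measurable_powR0y|exact: measurable_invXn].
- move=> y y0.
  have p0 (z : R) : 0 <= y `^ z by exact: powR_ge0.
  have y1 : 0 < 1 + y by rewrite addr_gt0.
  have e1 : 0 < 1 + y `^ e by rewrite ltr_pwDl.
  rewrite ger0_norm ?divr_ge0// ?exprn_ge0 ?(ltW y1)//.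
  rewrite ler_pdivrMr ?exprn_gt0// mulrA mulrAC ler_pdivlMr ?exprn_gt0//.
  (* below 1 the numerator decides, by e <= a; above 1 the growth at infinity
     does, by a + e <= m *)
  have [y_le1|/ltW y_ge1] := leP y 1.
    have h1 : y `^ (a - 1) <= y `^ (e - 1) by rewrite ger_powR ?y0// lerB.
    have h2 : (1 + y `^ e) ^+ 2 <= 4.
      have : y `^ e <= y `^ 0 by rewrite ger_powR ?y0// ltW.
      by rewrite powRr0; have := p0 e; nra.
    have h3 : 1 <= (1 + y) ^+ m by rewrite exprn_ege1// lerDl ltW.
    rewrite (le_trans (ler_pM _ _ h1 h2))// ?exprn_ge0 ?(ltW e1)//.
    by rewrite mulrC ler_peMr// mulr_ge0.
  have h2 : (1 + y `^ e) ^+ 2 <= 4 * (y `^ e * y `^ e).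
    have : y `^ 0 <= y `^ e by rewrite ler_powR// ltW.
    by rewrite powRr0; have := p0 e; nra.
  have h3 : y `^ m%:R <= (1 + y) ^+ m.
    by rewrite powR_mulrn ?(ltW y0)// lerXn2r ?nnegrE ?(ltW y0) ?(ltW y1)// lerDr.
  rewrite (le_trans (ler_wpM2l _ h2))// mulrCA -mulrA ler_pM2l//.
  apply: le_trans (ler_wpM2l _ h3) => //.
  rewrite -!powRD_gt0//.
  rewrite ler_powR// -subr_ge0.
  by rewrite (_ : _ - _ = m%:R - (a + e)) ?subr_ge0//; ring.
- exact: integrable_halflineZl (integrable_powR_majorant e0).
Qed.

(** A logarithm costs an arbitrarily small power at both ends, because
    [ln (y `^ z) < y `^ z] for [z] equal to [d] and to [- d]. *)
Lemma ln_le_powR (R : realType) (d y : R) : 0 < d -> 0 < y ->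
  `|ln y| <= d^-1 * (y `^ d + y `^ (- d)).
Proof.
move=> d0 y0; rewrite mulrC ler_pdivlMr// mulrC -{1}(gtr0_norm d0) -normrM -ln_powR.
have h z : ln (y `^ z) < y `^ z by apply: ln_sublinear; exact: powR_gt0.
have p z : 0 < y `^ z by exact: powR_gt0.
rewrite ler_norml; apply/andP; split.
  rewrite lerNl; have := h (- d); rewrite !ln_powR mulNr => /ltW/le_trans; apply.
  by rewrite lerDr ltW.
by apply: (le_trans (ltW (h d))); rewrite lerDl ltW.
Qed.

Lemma integrable_powR_ln_div (R : realType) (a : R) (m : nat) : 0 < a < m%:R ->
  leb.-integrable halfline
    (EFin \o (fun y => y `^ (a - 1) * `|ln y| / (1 + y) ^+ m)).
Proof.
move=> /andP[a0 am]; pose d := Num.min a (m%:R - a) / 2.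
have mi : 0 < Num.min a (m%:R - a) by rewrite lt_min a0 subr_gt0.
have d0 : 0 < d by rewrite divr_gt0.
have da : d < a.
  have : Num.min a (m%:R - a) <= a by rewrite ge_min lexx.
  by rewrite /d; lra.
have dm : d < m%:R - a.
  have : Num.min a (m%:R - a) <= m%:R - a by rewrite ge_min lexx orbT.
  by rewrite /d; lra.
have i1 : 0 < a + d < m%:R by apply/andP; split; lra.
have i2 : 0 < a - d < m%:R by apply/andP; split; lra.
apply: (@integrable_dominated _ _ (fun y => d^-1 *
  (y `^ (a + d - 1) / (1 + y) ^+ m + y `^ (a - d - 1) / (1 + y) ^+ m))).
- apply: measurable_funM; last exact: measurable_invXn.
  apply: measurable_funM; first exact: measurable_powR0y.
  apply: measurableT_comp => //.
  by apply: measurable_funTS; exact: measurable_ln.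
- move=> y y0.
  have y1 : 0 < (1 + y) ^+ m by rewrite exprn_gt0// addr_gt0.
  rewrite ger0_norm; last by rewrite !mulr_ge0// ?powR_ge0 ?invr_ge0 ?(ltW y1).
  rewrite -mulrDl mulrA ler_pM2r ?invr_gt0//.
  apply: (le_trans (ler_wpM2l (powR_ge0 _ _) (ln_le_powR d0 y0))).
  rewrite mulrCA mulrDr -!powRD_gt0//.
  by rewrite !(addrAC a (-1)).
- exact: integrable_halflineZl (integrable_halflineD
    (integrable_powR_div i1) (integrable_powR_div i2)).
Qed.

(** * Differentiation under the integral sign *)

Lemma is_derive_under_integral (R : realType) (f df : R -> R -> R) (G : R -> R)
    (a u v : R) :
  a \in `]u, v[ ->
  (forall x, x \in `]u, v[ -> leb.-integrable halfline (EFin \o f x)) ->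
  (forall x y : R, x \in `]u, v[ -> 0 < y -> is_derive x 1 (f ^~ y) (df x y)) ->
  leb.-integrable halfline (EFin \o G) ->
  (forall x y : R, x \in `]u, v[ -> 0 < y -> `|df x y| <= G y) ->
  is_derive a 1 (fun x => \int[leb]_(y in halfline) f x y)
    (\int[leb]_(y in halfline) df a y).
Proof.
move=> auv intf dE intG dG.
have pE (x y : R) : x \in `]u, v[ -> 0 < y -> partial1of2 f x y = df x y.
  move=> xuv y0; rewrite partial1of2E; have := dE x y xuv y0 => h.
  by rewrite derive_val.
have inD (y : R) : halfline y -> 0 < y by rewrite /= in_itv/= andbT.
have A1 : `]u, v[%classic a by [].
have A2 x : `]u, v[%classic x -> leb.-integrable halfline (EFin \o f x).
  exact: intf.
have A3 (x y : R) : `]u, v[%classic x -> halfline y -> derivable (f ^~ y) x 1.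
  by move=> xuv /inD y0; have := dE x y xuv y0 => h; exact: ex_derive.
have A4 (x y : R) : `]u, v[%classic x -> halfline y ->
    `|partial1of2 f x y| <= `|G y|.
  move=> xuv /inD y0; rewrite pE//.
  by apply: (le_trans (dG _ _ xuv y0)); exact: ler_norm.
have A5 (y : R) : 0 <= `|G y| by [].
have iG := integrable_norm intG.
have c := @cvg_differentiation_under_integral R _ _ leb f halfline
  (measurable_itv _) _ _ _ A1 A2 A3 _ A5 iG A4.
have e := @differentiation_under_integral R _ _ leb f halfline
  (measurable_itv _) _ _ _ A1 A2 A3 _ A5 iG A4.
have d := @derivable_under_integral R _ _ leb f halfline
  (measurable_itv _) _ _ _ A1 A2 A3 _ A5 iG A4.
split => //; rewrite -derive1E e; apply: eq_Rintegral => y.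
by rewrite inE => /inD y0; rewrite pE.
Qed.

Lemma integrable_powR_mul (R : realType) (h : R -> R) (K a : R) (m : nat) :
  measurable_fun (halfline : set R) h ->
  (forall y : R, 0 < y -> `|h y| <= K / (1 + y) ^+ m) ->
  0 < a < m%:R ->
  leb.-integrable halfline (EFin \o (fun y => y `^ (a - 1) * h y)).
Proof.
move=> mh hK am; apply: (@integrable_dominated _ _
  (fun y => K * (y `^ (a - 1) / (1 + y) ^+ m))).
- by apply: measurable_funM => //; exact: measurable_powR0y.
- move=> y y0; rewrite normrM ger0_norm ?powR_ge0// mulrCA.
  by apply: ler_wpM2l (hK y y0); exact: powR_ge0.
- exact: integrable_halflineZl (integrable_powR_div am).
Qed.

Lemma integrable_powR_ln_mul (R : realType) (h : R -> R) (K a : R) (m : nat) :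
  measurable_fun (halfline : set R) h ->
  (forall y : R, 0 < y -> `|h y| <= K / (1 + y) ^+ m) ->
  0 < a < m%:R ->
  leb.-integrable halfline (EFin \o (fun y => y `^ (a - 1) * ln y * h y)).
Proof.
move=> mh hK am; apply: (@integrable_dominated _ _
  (fun y => K * (y `^ (a - 1) * `|ln y| / (1 + y) ^+ m))).
- apply: measurable_funM => //; apply: measurable_funM.
    exact: measurable_powR0y.
  by apply: measurable_funTS; exact: measurable_ln.
- move=> y y0; rewrite !normrM ger0_norm ?powR_ge0// mulrCA.
  by apply: ler_wpM2l (hK y y0); rewrite mulr_ge0// powR_ge0.
- exact: integrable_halflineZl (integrable_powR_ln_div am).
Qed.

(** Differentiating [y `^ (a - 1)] in [a] brings out the factor [ln y]. Near [a]
    the exponents stay between [a - d] and [a + d], so the sum of the two extreme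
    powers dominates the derivatives uniformly. *)
Lemma is_derive_Mellin (R : realType) (h : R -> R) (K a : R) (m : nat) :
  measurable_fun (halfline : set R) h ->
  (forall y : R, 0 < y -> `|h y| <= K / (1 + y) ^+ m) ->
  0 < a < m%:R ->
  is_derive a 1 (fun a => \int[leb]_(y in halfline) (y `^ (a - 1) * h y))
    (\int[leb]_(y in halfline) (y `^ (a - 1) * ln y * h y)).
Proof.
move=> mh hK /andP[a0 am]; pose d := Num.min a (m%:R - a) / 2.
have mi : 0 < Num.min a (m%:R - a) by rewrite lt_min a0 subr_gt0.
have d0 : 0 < d by rewrite divr_gt0.
have da : d < a.
  have : Num.min a (m%:R - a) <= a by rewrite ge_min lexx.
  by rewrite /d; lra.
have dm : d < m%:R - a.
  have : Num.min a (m%:R - a) <= m%:R - a by rewrite ge_min lexx orbT.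
  by rewrite /d; lra.
have i1 : 0 < a + d < m%:R by apply/andP; split; lra.
have i2 : 0 < a - d < m%:R by apply/andP; split; lra.
apply: (@is_derive_under_integral _ (fun a y => y `^ (a - 1) * h y)
  (fun a y => y `^ (a - 1) * ln y * h y)
  (fun y => K * (y `^ (a + d - 1) * `|ln y| / (1 + y) ^+ m)
          + K * (y `^ (a - d - 1) * `|ln y| / (1 + y) ^+ m)) a (a - d) (a + d)).
- by rewrite in_itv/=; apply/andP; split; lra.
- move=> x; rewrite in_itv/= => /andP[x1 x2].
  by apply: (integrable_powR_mul mh hK); apply/andP; split; lra.
- move=> x y _ y0.
  have E : (fun x => y `^ (x - 1) * h y) = (fun x => expR ((x - 1) * ln y) * h y).
    by apply/funext => z; rewrite /powR gt_eqF.
  rewrite E; derive; rewrite /powR gt_eqF//; ring.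
- exact: integrable_halflineD (integrable_halflineZl _ (integrable_powR_ln_div i1))
    (integrable_halflineZl _ (integrable_powR_ln_div i2)).
- move=> x y; rewrite in_itv/= => /andP[x1 x2] y0.
  have py (q : R) : 0 <= y `^ q by exact: powR_ge0.
  have le2 : y `^ (x - 1) <= y `^ (a + d - 1) + y `^ (a - d - 1).
    have [y1|/ltW y1] := leP y 1.
      rewrite -[leLHS]add0r lerD// ger_powR ?y0//; lra.
    rewrite -[leLHS]addr0 lerD// ler_powR//; lra.
  rewrite !normrM (ger0_norm (py _)).
  apply: (le_trans (ler_pM _ _ (ler_wpM2r (normr_ge0 (ln y)) le2) (hK y y0))).
  - by rewrite mulr_ge0.
  - by [].
  - by rewrite le_eqVlt; apply/orP; left; apply/eqP; ring.
Qed.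

(** * The rotated Stieltjes kernel *)

(** The squared distance from [- y] to [r e^(i t)], that is
    [|y + r e^(i t)| ^+ 2]. *)
Definition sqdist (R : realType) (r t y : R) : R :=
  (y + r * cos t) ^+ 2 + (r * sin t) ^+ 2.

(** Written with half-angles, [1 + cos t] and [1 - cos t] are twice a squared
    cosine and a squared sine. All lower bounds on the denominator come from this
    decomposition. *)
Lemma sqdist_split (R : realType) (r t y : R) :
  sqdist r t y = ((1 + cos t) * (y + r) ^+ 2 + (1 - cos t) * (y - r) ^+ 2) / 2.
Proof.
rewrite /sqdist exprMn -[sin t ^+ 2](addrK (cos t ^+ 2)) [sin t ^+ 2 + _]addrC.
by rewrite cos2Dsin2; field.
Qed.

Lemma sqdist_ge (R : realType) (r t y : R) :
  (1 + cos t) / 2 * (y + r) ^+ 2 <= sqdist r t y.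
Proof.
rewrite sqdist_split -subr_ge0.
have -> : ((1 + cos t) * (y + r) ^+ 2 + (1 - cos t) * (y - r) ^+ 2) / 2 -
   (1 + cos t) / 2 * (y + r) ^+ 2 = (1 - cos t) * (y - r) ^+ 2 / 2 by ring.
by rewrite divr_ge0// mulr_ge0// ?sqr_ge0// subr_ge0 cos_le1.
Qed.

Lemma cos_gtN1 (R : realType) (t : R) : `|t| < pi -> 0 < (1 + cos t) / 2.
Proof.
move=> tpi; rewrite divr_gt0// -ltrBlDl sub0r.
have -> : cos t = cos `|t|.
  by have [?|?] := ger0P t; rewrite ?cosN.
rewrite -cospi ltr_cos ?in_itv/= ?normr_ge0 ?(ltW tpi) ?pi_ge0 ?lexx//.
Qed.

Lemma sqdist_gt0 (R : realType) (r t y : R) : 0 < r -> 0 <= y -> `|t| < pi ->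
  0 < sqdist r t y.
Proof.
move=> r0 y0 tpi; apply: lt_le_trans (sqdist_ge _ _ _).
by rewrite mulr_gt0 ?cos_gtN1// exprn_gt0// ltr_wpDl.
Qed.

(** Real part of [e^(i al) (y + r e^(- i t))]. Divided by [sqdist r t y] it is the
    real part of [e^(i al) / (y + r e^(i t))], the Stieltjes kernel at the point
    [r e^(i t)] turned by the angle [al]. *)
Definition rotRe (R : realType) (r t al y : R) : R :=
  cos al * (y + r * cos t) + sin al * (r * sin t).

(** Imaginary part of [e^(i al) (y + r e^(- i t))]. *)
Definition rotIm (R : realType) (r t al y : R) : R :=
  sin al * (y + r * cos t) - cos al * (r * sin t).

Lemma rotRe_rotIm (R : realType) (r t al y : R) :
  rotRe r t al y ^+ 2 + rotIm r t al y ^+ 2 = sqdist r t y.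
Proof.
rewrite -[RHS]mul1r -(cos2Dsin2 al) /rotRe /rotIm /sqdist; ring.
Qed.

Lemma sqdist_le (R : realType) (r t y : R) : 0 < r -> 0 <= y ->
  sqdist r t y <= (y + r) ^+ 2.
Proof.
move=> r0 y0; rewrite sqdist_split -subr_ge0.
have -> : (y + r) ^+ 2 -
    ((1 + cos t) * (y + r) ^+ 2 + (1 - cos t) * (y - r) ^+ 2) / 2 =
    (1 - cos t) * (2 * y * r) by field.
by rewrite mulr_ge0 ?subr_ge0 ?cos_le1// !mulr_ge0// ltW.
Qed.

Lemma rotRe_le (R : realType) (r t al y : R) : 0 < r -> 0 <= y ->
  `|rotRe r t al y| <= y + r.
Proof.
move=> r0 y0; have yr : 0 <= y + r by rewrite addr_ge0// ltW.
rewrite -(ger0_norm yr) -ler_sqr ?nnegrE// !real_normK ?num_real//.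
apply: le_trans (sqdist_le t r0 y0).
by rewrite -(rotRe_rotIm r t al y) lerDl sqr_ge0.
Qed.

Lemma rotIm_le (R : realType) (r t al y : R) : 0 < r -> 0 <= y ->
  `|rotIm r t al y| <= y + r.
Proof.
move=> r0 y0; have yr : 0 <= y + r by rewrite addr_ge0// ltW.
rewrite -(ger0_norm yr) -ler_sqr ?nnegrE// !real_normK ?num_real//.
apply: le_trans (sqdist_le t r0 y0).
by rewrite -(rotRe_rotIm r t al y) lerDr sqr_ge0.
Qed.

(** The factor of [y `^ (b - 1)] both in the [t]-derivative of the real part and
    in the [y]-derivative of the imaginary part of the rotated kernel. *)
Definition rotD (R : realType) (b r t al y : R) : R :=
  (b * rotIm r t al y * sqdist r t y + y * sin al * sqdist r t y
   - 2 * y * rotIm r t al y * (y + r * cos t)) / sqdist r t y ^+ 2.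

(** Together with [is_derive_rotIm] this is a Cauchy-Riemann equation: the kernel
    [y `^ (b - 1) / (y + w)] is homogeneous of degree [b - 2] in [(y, w)], so
    after multiplication by [e^(i (1 - b) t)] turning [w] amounts to
    differentiating along the ray of integration. *)
Lemma is_derive_rotRe (R : realType) (b r ph t y : R) :
  sqdist r t y != 0 ->
  is_derive t 1
    (fun t => y `^ (b - 1) *
       (rotRe r t ((1 - b) * t + ph) y / sqdist r t y))
    (y `^ (b - 1) * rotD b r t ((1 - b) * t + ph) y).
Proof.
move=> D0; rewrite /rotRe /sqdist in D0 *.
derive; rewrite /= /rotD /rotIm /sqdist; by field.
Qed.

Lemma is_derive_rotIm (R : realType) (b r t al y : R) : 0 < y ->
  sqdist r t y != 0 ->
  is_derive y 1 (fun y => y `^ b * (rotIm r t al y / sqdist r t y))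
    (y `^ (b - 1) * rotD b r t al y).
Proof.
move=> y0 D0; rewrite /rotIm /sqdist in D0 *.
have E : y `^ b = y * y `^ (b - 1).
  by rewrite -[X in X * _]powRr1 ?ltW// -powRD_gt0// addrC subrK.
derive; rewrite /= E /rotD /rotIm /sqdist; by field.
Qed.

Lemma rotD_le (R : realType) (b r t al y k : R) : 0 < b < 1 -> 0 < r -> 0 <= y ->
  0 < k -> k <= (1 + cos t) / 2 ->
  `|rotD b r t al y| <= 4 / k ^+ 2 / (y + r).
Proof.
move=> /andP[b0 b1] r0 y0 k0 kt.
have yr : 0 < y + r by rewrite ltr_wpDl.
have Dk : k * (y + r) ^+ 2 <= sqdist r t y.
  by apply: le_trans (sqdist_ge _ _ _); rewrite ler_wpM2r ?sqr_ge0.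
have D0 : 0 < sqdist r t y by apply: lt_le_trans Dk; rewrite mulr_gt0// exprn_gt0.
have Dle := sqdist_le t r0 y0.
have M1 := rotIm_le t al r0 y0.
have c1 : `|y + r * cos t| <= y + r.
  rewrite (le_trans (ler_normD _ _))// (ger0_norm y0) normrM (gtr0_norm r0) lerD2l.
  by rewrite ler_piMr ?(ltW r0)// ler_norml cos_geN1 cos_le1.
have s1 : `|sin al| <= 1 by rewrite ler_norml sin_geN1 sin_le1.
rewrite /rotD normrM normfV (gtr0_norm (exprn_gt0 2 D0)).
set nu := `|_|.
have Hn : nu <= 4 * (y + r) ^+ 3.
  rewrite /nu; apply: (le_trans (ler_normB _ _)); apply: (@le_trans _ _
    (2 * (y + r) ^+ 3 + 2 * (y + r) ^+ 3)); last first.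
    by rewrite -mulrDl; apply: ler_wpM2r; [rewrite exprn_ge0// ltW|lra].
  have yle : y <= y + r by rewrite lerDl ltW.
  apply: lerD.
    apply: (le_trans (ler_normD _ _)).
    rewrite (_ : 2 * _ = (y + r) * (y + r) ^+ 2 + (y + r) * (y + r) ^+ 2); last by ring.
    apply: lerD.
      rewrite !normrM (gtr0_norm D0) (gtr0_norm b0).
      rewrite ler_pM ?mulr_ge0 ?(ltW D0) ?(ltW b0)//.
      by rewrite -[leRHS]mul1r ler_pM ?(ltW b0) ?(ltW b1).
    rewrite !normrM (gtr0_norm D0) (ger0_norm y0) ler_pM ?mulr_ge0 ?(ltW D0)//.
    by rewrite -[leRHS]mulr1 ler_pM.
  rewrite !normrM (ger0_norm y0) (ger0_norm (ler0n _ 2)) -!mulrA.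
  apply: ler_wpM2l => //; rewrite exprS expr2.
  by rewrite ler_pM ?mulr_ge0// ler_pM.
rewrite ler_pdivrMr ?exprn_gt0//; apply: (le_trans Hn).
have -> : 4 * (y + r) ^+ 3 = 4 / k ^+ 2 / (y + r) * (k * (y + r) ^+ 2) ^+ 2.
  by field; rewrite !gt_eqF.
rewrite ler_wpM2l//; first by rewrite !divr_ge0// ?exprn_ge0// ltW.
by rewrite lerXn2r// nnegrE ?mulr_ge0 ?exprn_ge0 ?(ltW yr) ?(ltW k0) ?(ltW D0).
Qed.

Lemma over_sqdist_le (R : realType) (r t x y k : R) : 0 < r -> 0 <= y ->
  0 < k -> k <= (1 + cos t) / 2 -> `|x| <= y + r ->
  `|x / sqdist r t y| <= k^-1 / (y + r).
Proof.
move=> r0 y0 k0 kt xyr.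
have yr : 0 < y + r by rewrite ltr_wpDl.
have Dk : k * (y + r) ^+ 2 <= sqdist r t y.
  by apply: le_trans (sqdist_ge _ _ _); rewrite ler_wpM2r ?sqr_ge0.
have D0 : 0 < sqdist r t y by apply: lt_le_trans Dk; rewrite mulr_gt0// exprn_gt0.
rewrite normrM normfV (gtr0_norm D0) ler_pdivrMr//; apply: (le_trans xyr).
have {1}-> : (y + r) = k^-1 / (y + r) * (k * (y + r) ^+ 2).
  by field; rewrite !gt_eqF.
by rewrite ler_wpM2l// divr_ge0 ?invr_ge0 ?(ltW k0) ?(ltW yr).
Qed.

(** * Independence of the angle *)

Lemma is_derive_0_cst_oo (R : realType) (f : R -> R) (u v x y : R) :
  (forall z, z \in `]u, v[ -> is_derive z 1 f 0) ->
  x \in `]u, v[ -> y \in `]u, v[ -> f x = f y.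
Proof.
move=> df; wlog xy : x y / x <= y => [H|].
  by move=> xi yi; have [xy|/ltW yx] := leP x y; [|symmetry]; apply: H.
rewrite !in_itv/= => /andP[ux _] /andP[_ yv].
have din z : z \in `[x, y] -> is_derive z 1 f 0.
  rewrite in_itv/= => /andP[xz zy]; apply: df; rewrite in_itv/=.
  by rewrite (lt_le_trans ux xz) (le_lt_trans zy yv).
have din' z : z \in `]x, y[ -> is_derive z 1 f 0.
  by rewrite in_itv/= => /andP[xz zy]; apply: din; rewrite in_itv/= !ltW.
have cf : {within `[x, y], continuous f}.
  by apply: derivable_within_continuous => z /din; exact: is_derive1_derivable.
have [c _] := MVT_segment xy din' cf.
by rewrite mul0r => /eqP; rewrite subr_eq0 => /eqP.
Qed.

Lemma derivable_measurable_div (R : realType) (f g : R -> R) :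
  (forall y : R, 0 < y -> derivable f y 1) ->
  (forall y : R, 0 < y -> derivable g y 1) ->
  (forall y : R, 0 < y -> g y != 0) ->
  measurable_fun (halfline : set R) (fun y => f y / g y).
Proof.
move=> df dg g0; apply: derivable_measurable_0y => y y0.
have /derivableP f1 := df _ y0; have /derivableP g1 := dg _ y0; derivable.
exact: g0.
Qed.

(** Comparison of a pole at [- r] with a pole at [- 1], which brings all kernels
    to one shape of majorant. *)
Lemma inv_shift_le (R : realType) (r y c : R) : 0 < r -> 0 <= y -> 0 <= c ->
  c / (y + r) <= c / Num.min 1 r / (1 + y) ^+ 1.
Proof.
move=> r0 y0 c0; rewrite expr1 -mulrA ler_wpM2l// -invfM lef_pV2 ?posrE.
- rewrite mulrDr mulr1 [leRHS]addrC lerD// ?ge_min ?lexx ?orbT//.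
  by rewrite ler_piMl// ge_min lexx.
- by rewrite ltr_wpDl.
- by apply: mulr_gt0; [rewrite lt_min ltr01 r0|rewrite ltr_wpDr].
Qed.

Lemma measurable_rotRe (R : realType) (r t al : R) : 0 < r -> `|t| < pi ->
  measurable_fun (halfline : set R) (fun y => rotRe r t al y / sqdist r t y).
Proof.
move=> r0 tpi; apply: derivable_measurable_div.
- by move=> y _; rewrite /rotRe; derivable.
- by move=> y _; rewrite /sqdist; derivable.
- by move=> y y0; rewrite gt_eqF// sqdist_gt0// ltW.
Qed.

Lemma derivable_rotD (R : realType) (b r t al y : R) :
  0 < r -> `|t| < pi -> 0 < y -> derivable (rotD b r t al) y 1.
Proof.
move=> r0 tpi y0; have := sqdist_gt0 r0 (ltW y0) tpi => D0.
rewrite /rotD /rotIm /sqdist in D0 *; derivable.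
by rewrite expf_neq0// gt_eqF.
Qed.

Lemma integrable_rotRe (R : realType) (b r t al : R) :
  0 < b < 1 -> 0 < r -> `|t| < pi ->
  leb.-integrable halfline
    (EFin \o (fun y => y `^ (b - 1) * (rotRe r t al y / sqdist r t y))).
Proof.
move=> b01 r0 tpi; have k0 := cos_gtN1 tpi.
apply: (@integrable_powR_mul _ _ (((1 + cos t) / 2)^-1 / Num.min 1 r) b 1) => //.
  exact: measurable_rotRe.
move=> y /ltW y0; apply: (le_trans _ (inv_shift_le r0 y0 _)).
  by apply: over_sqdist_le => //; exact: rotRe_le.
by rewrite invr_ge0 ltW.
Qed.

Lemma integrable_rotD (R : realType) (b r t al : R) :
  0 < b < 1 -> 0 < r -> `|t| < pi ->
  leb.-integrable halfline (EFin \o (fun y => y `^ (b - 1) * rotD b r t al y)).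
Proof.
move=> b01 r0 tpi; have k0 := cos_gtN1 tpi.
apply: (@integrable_powR_mul _ _ (4 / ((1 + cos t) / 2) ^+ 2 / Num.min 1 r) b 1) => //.
  by apply: derivable_measurable_0y => y y0; exact: derivable_rotD.
move=> y /ltW y0; apply: (le_trans _ (inv_shift_le r0 y0 _)).
  exact: rotD_le.
by rewrite divr_ge0// exprn_ge0// ltW.
Qed.

(** The integrand is the derivative of [y `^ b * rotIm / sqdist], which is
    [O(y `^ b)] at 0 and [O(y `^ (b - 1))] at infinity. *)
Lemma Rintegral_rotD (R : realType) (b r t al : R) :
  0 < b < 1 -> 0 < r -> `|t| < pi ->
  \int[leb]_(y in halfline) (y `^ (b - 1) * rotD b r t al y) = 0.
Proof.
move=> b01 r0 tpi; have /andP[b0 b1] := b01; have k0 := cos_gtN1 tpi.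
have Fle y : 0 < y ->
    `|y `^ b * (rotIm r t al y / sqdist r t y)| <=
      ((1 + cos t) / 2)^-1 / r * y `^ b /\
    `|y `^ b * (rotIm r t al y / sqdist r t y)| <=
      ((1 + cos t) / 2)^-1 * y `^ (- (1 - b)).
  move=> y0; rewrite normrM (ger0_norm (powR_ge0 _ _)).
  have h := over_sqdist_le r0 (ltW y0) k0 (lexx _) (rotIm_le t al r0 (ltW y0)).
  have k1 : 0 <= ((1 + cos t) / 2)^-1 by rewrite invr_ge0 ltW.
  split.
    rewrite mulrC ler_wpM2r ?powR_ge0// (le_trans h)// ler_wpM2l//.
    by rewrite lef_pV2 ?posrE ?addr_gt0// lerDr ltW.
  apply: (le_trans (ler_wpM2l (powR_ge0 _ _) h)).
  rewrite mulrCA ler_wpM2l// opprB powRD_gt0// ler_wpM2l ?powR_ge0//.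
  by rewrite powR_inv1 ?(ltW y0)// lef_pV2 ?posrE ?addr_gt0// lerDl ltW.
rewrite -[RHS](subr0 0).
apply: (@FTC_0y R (fun y => y `^ (b - 1) * rotD b r t al y)
  (fun y => y `^ b * (rotIm r t al y / sqdist r t y)) 0 0).
- by move=> y y0; apply: is_derive_rotIm => //; rewrite gt_eqF// sqdist_gt0// ltW.
- move=> y y0; have /derivableP := @derivable_rotD _ b _ _ al _ r0 tpi y0 => h.
  by derivable.
- exact: integrable_rotD.
- apply: norm_cvg0; apply: (@squeeze_cvgr _ _ _ _ (fun=> 0)
    (fun y => ((1 + cos t) / 2)^-1 / r * y `^ b)).
  + near=> y; have y0 : 0 < y by near: y; exact: nbhs_right_gt.
    by rewrite normr_ge0/=; exact: (Fle _ y0).1.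
  + exact: cvg_cst.
  + by have := cvgM (cvg_cst (((1 + cos t) / 2)^-1 / r)) (powR_cvg0 b0);
      rewrite mulr0; apply.
- apply: norm_cvg0; apply: (@squeeze_cvgr _ _ _ _ (fun=> 0)
    (fun y => ((1 + cos t) / 2)^-1 * y `^ (- (1 - b)))).
  + near=> y; have y0 : 0 < y by near: y; exact: nbhs_pinfty_gt.
    by rewrite normr_ge0/=; exact: (Fle _ y0).2.
  + exact: cvg_cst.
  + have b1' : 0 < 1 - b by rewrite subr_gt0.
    by have := cvgM (cvg_cst (((1 + cos t) / 2)^-1)) (powRN_cvgy0 b1');
      rewrite mulr0; apply.
Unshelve. all: end_near. Qed.

Lemma is_derive_rot_integral (R : realType) (b r ph t : R) :
  0 < b < 1 -> 0 < r -> `|t| < pi ->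
  is_derive t 1 (fun t => \int[leb]_(y in halfline) (y `^ (b - 1) *
    (rotRe r t ((1 - b) * t + ph) y / sqdist r t y))) 0.
Proof.
move=> b01 r0 tpi.
(* an interval of angles around t that stays away from the angles - pi and pi,
   where the denominators vanish *)
pose v := (`|t| + pi) / 2.
have tv : `|t| < v by rewrite /v; lra.
have vpi : v < pi by rewrite /v; lra.
have v0 : 0 <= v by apply: le_trans (ltW tv).
have vpi' : `|v| < pi by rewrite ger0_norm.
have k0 := cos_gtN1 vpi'.
have vin x : x \in `](- v), v[ -> `|x| < v by rewrite in_itv/= ltr_norml.
have kx x : x \in `](- v), v[ -> (1 + cos v) / 2 <= (1 + cos x) / 2.
  move=> /vin xv; rewrite ler_pM2r ?invr_gt0// lerD2l.
  have -> : cos x = cos `|x| by have [?|?] := ger0P x; rewrite ?cosN.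
  apply: ltW.
  by rewrite ltr_cos ?in_itv/= ?normr_ge0 ?v0 ?(ltW xv) ?(ltW vpi)//
    (ltW (lt_trans xv vpi)).
rewrite -[X in is_derive _ _ _ X](Rintegral_rotD ((1 - b) * t + ph) b01 r0 tpi).
apply: (@is_derive_under_integral _
  (fun t y => y `^ (b - 1) * (rotRe r t ((1 - b) * t + ph) y / sqdist r t y))
  (fun t y => y `^ (b - 1) * rotD b r t ((1 - b) * t + ph) y)
  (fun y => y `^ (b - 1) * (4 / ((1 + cos v) / 2) ^+ 2 / Num.min 1 r / (1 + y) ^+ 1))
  t (- v) v).
- by rewrite in_itv/= -ltr_norml.
- by move=> x /vin xv; apply: integrable_rotRe => //; exact: lt_trans vpi.
- move=> x y /vin xv y0; apply: is_derive_rotRe.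
  by rewrite gt_eqF// sqdist_gt0// ?(lt_trans xv vpi)// ltW.
- apply: (@integrable_powR_mul _ _
    (4 / ((1 + cos v) / 2) ^+ 2 / Num.min 1 r) b 1) => //.
    apply: derivable_measurable_div => y y0; [by derivable|by derivable|].
    by rewrite expf_neq0// gt_eqF// addr_gt0.
  move=> y y0; rewrite ger0_norm// !mulr_ge0 ?invr_ge0 ?exprn_ge0 ?(ltW k0)//.
    by rewrite le_min ler01 ltW.
  by rewrite addr_ge0// ltW.
- move=> x y xv /ltW y0; rewrite normrM (ger0_norm (powR_ge0 _ _)).
  rewrite ler_wpM2l ?powR_ge0//; apply: (le_trans _ (inv_shift_le r0 y0 _)).
    by apply: rotD_le => //; exact: kx.
  by rewrite divr_ge0// exprn_ge0// ltW.
Qed.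

(** The transform at [r e^(i t)] is thus known from the one at the positive number
    [r]; this takes the place of turning the contour of integration. *)
Lemma rot_integral_cst (R : realType) (b r ph t : R) :
  0 < b < 1 -> 0 < r -> `|t| < pi ->
  \int[leb]_(y in halfline) (y `^ (b - 1) *
    (rotRe r t ((1 - b) * t + ph) y / sqdist r t y)) =
  \int[leb]_(y in halfline) (y `^ (b - 1) * (cos ph / (y + r))).
Proof.
move=> b01 r0 tpi.
have h0 : (0 : R) \in `](- pi), pi[ by rewrite in_itv/= oppr_lt0 !pi_gt0.
have ht : t \in `](- pi), pi[ by rewrite in_itv/= -ltr_norml.
pose F t := \int[leb]_(y in halfline) (y `^ (b - 1) *
    (rotRe r t ((1 - b) * t + ph) y / sqdist r t y)).
have dF z : z \in `](- pi), pi[ -> is_derive z 1 F 0.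
  by rewrite in_itv/= -ltr_norml; exact: is_derive_rot_integral.
rewrite -/(F t) (is_derive_0_cst_oo dF ht h0).
apply: eq_Rintegral => y; rewrite inE/= in_itv/= andbT => y0; congr (_ * _).
rewrite /rotRe /sqdist mulr0 add0r cos0 sin0; field.
by rewrite gt_eqF// addr_gt0.
Qed.

(** * The value of the constant, from the Poisson kernel *)

(** The transform at the positive number [r]. By homogeneity it is a multiple of
    [r `^ (b - 1)]; [stieltjes_cst_sin] finds the multiple. *)
Definition stieltjes_cst (R : realType) (b r : R) : R :=
  \int[leb]_(y in halfline) (y `^ (b - 1) * (y + r)^-1).

Lemma integrable_stieltjes_cst (R : realType) (b r : R) : 0 < b < 1 -> 0 < r ->
  leb.-integrable halfline (EFin \o (fun y => y `^ (b - 1) * (y + r)^-1)).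
Proof.
move=> b01 r0.
apply: (@integrable_powR_mul _ _ (1 / Num.min 1 r) b 1) => //.
  apply: derivable_measurable_0y => y y0; derivable.
  by rewrite gt_eqF// addr_gt0.
move=> y y0; rewrite ger0_norm ?invr_ge0 ?addr_ge0 ?(ltW y0) ?(ltW r0)//.
by rewrite -[leLHS]mul1r; apply: inv_shift_le; rewrite ?(ltW y0).
Qed.

(** An arbitrary phase [ph] is reached from [rot_integral_cst] by giving its free
    phase the value [ph - (1 - b) * t]. *)
Lemma rot_integral (R : realType) (b r t ph : R) :
  0 < b < 1 -> 0 < r -> `|t| < pi ->
  \int[leb]_(y in halfline) (y `^ (b - 1) * (rotRe r t ph y / sqdist r t y)) =
  stieltjes_cst b r * cos (ph - (1 - b) * t).
Proof.
move=> b01 r0 tpi.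
have := rot_integral_cst (ph - (1 - b) * t) b01 r0 tpi.
have -> : (1 - b) * t + (ph - (1 - b) * t) = ph by ring.
move=> ->; rewrite [stieltjes_cst b r * _]mulrC /stieltjes_cst.
rewrite -Rintegral_halflineZl; last exact: integrable_stieltjes_cst.
by apply: eq_Rintegral => y _; rewrite mulrCA.
Qed.

Lemma stieltjes_Re (R : realType) (b r t : R) :
  0 < b < 1 -> 0 < r -> `|t| < pi ->
  \int[leb]_(y in halfline) (y `^ (b - 1) * ((y + r * cos t) / sqdist r t y)) =
  stieltjes_cst b r * cos ((1 - b) * t).
Proof.
move=> b01 r0 tpi.
have -> : cos ((1 - b) * t) = cos (0 - (1 - b) * t) by rewrite sub0r cosN.
rewrite -rot_integral//.
by apply: eq_Rintegral => y _; rewrite /rotRe cos0 sin0 mul1r mul0r addr0.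
Qed.

Lemma stieltjes_Im (R : realType) (b r t : R) :
  0 < b < 1 -> 0 < r -> `|t| < pi ->
  \int[leb]_(y in halfline) (y `^ (b - 1) * (r * sin t / sqdist r t y)) =
  stieltjes_cst b r * sin ((1 - b) * t).
Proof.
move=> b01 r0 tpi.
have -> : sin ((1 - b) * t) = cos (pi / 2 - (1 - b) * t).
  by rewrite cosB cos_pihalf sin_pihalf mul0r mul1r add0r.
rewrite -rot_integral//.
apply: eq_Rintegral => y _.
by rewrite /rotRe cos_pihalf sin_pihalf mul1r mul0r add0r.
Qed.

Lemma is_derive_atan_poisson (R : realType) (r t y : R) :
  0 < r -> 0 < t < pi ->
  is_derive y 1 (fun y => atan ((y + r * cos t) / (r * sin t)))
    (r * sin t / sqdist r t y).
Proof.
move=> r0 t0pi; have s0 : 0 < sin t by apply: sin_gt0_pi.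
have d1 : is_derive y 1 (fun y => (y + r * cos t) / (r * sin t)) (r * sin t)^-1.
  by derive; rewrite /=; field; rewrite !gt_eqF.
apply: (is_derive_eq (is_derive1_comp (is_derive1_atan _) d1)).
have n1 : (r * sin t) ^+ 2 + (y + r * cos t) ^+ 2 != 0.
  by rewrite gt_eqF// ltr_pwDl ?sqr_ge0// exprn_gt0// mulr_gt0.
by rewrite /sqdist; field; rewrite addrC n1 !gt_eqF.
Qed.

Lemma atan_poisson_cvg (R : realType) (r t : R) : 0 < r -> 0 < t < pi ->
  atan ((y + r * cos t) / (r * sin t)) @[y --> 0^'+] --> pi / 2 - t /\
  atan ((y + r * cos t) / (r * sin t)) @[y --> +oo] --> pi / 2.
Proof.
move=> r0 t0pi; have /andP[t0 tpi] := t0pi.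
have s0 : 0 < sin t by apply: sin_gt0_pi.
have rs0 : 0 < r * sin t by rewrite mulr_gt0.
split.
  have -> : pi / 2 - t = atan ((0 + r * cos t) / (r * sin t)).
    have -> : (0 + r * cos t) / (r * sin t) = tan (pi / 2 - t).
      rewrite /tan sinB cosB cos_pihalf sin_pihalf.
      by field; rewrite !gt_eqF.
    by rewrite tanK// in_itv/=; apply/andP; split; lra.
  apply: cvg_at_right_filter.
  apply: differentiable_continuous; apply/derivable1_diffP.
  exact: is_derive1_derivable (is_derive_atan_poisson 0 r0 t0pi).
apply: (cvg_comp _ _ _ (@cvgy_atan R)).
apply/cvgryPge => A; near=> y; rewrite ler_pdivlMr// -lerBlDr.
by near: y; apply: nbhs_pinfty_ge; exact: num_real.
Unshelve. all: end_near. Qed.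

Lemma derivable_poisson (R : realType) (r t y : R) :
  0 < r -> `|t| < pi -> 0 < y ->
  derivable (fun y => r * sin t / sqdist r t y) y 1.
Proof.
move=> r0 tpi y0; have := lt0r_neq0 (sqdist_gt0 r0 (ltW y0) tpi) => D0.
by rewrite /sqdist in D0 *; derivable.
Qed.

Lemma poisson_integrable (R : realType) (r t : R) : 0 < r -> 0 < t < pi ->
  leb.-integrable halfline (EFin \o (fun y => r * sin t / sqdist r t y)).
Proof.
move=> r0 t0pi; have [A B] := atan_poisson_cvg r0 t0pi.
have /andP[t0 tpi] := t0pi.
have s0 : 0 < sin t by apply: sin_gt0_pi.
apply: (@ge0_FTC_0y_integrable R (fun y => r * sin t / sqdist r t y) _ _ _ _ _ _ A B).
- by move=> y _; exact: is_derive_atan_poisson.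
- by move=> y; apply: derivable_poisson => //; rewrite gtr0_norm.
- by move=> y _; rewrite divr_ge0 ?addr_ge0 ?sqr_ge0// mulr_ge0 ?(ltW r0) ?(ltW s0).
Qed.

Lemma poisson_integral (R : realType) (r t : R) : 0 < r -> 0 < t < pi ->
  \int[leb]_(y in halfline) (r * sin t / sqdist r t y) = t.
Proof.
move=> r0 t0pi; have [A B] := atan_poisson_cvg r0 t0pi.
have /andP[t0 tpi] := t0pi.
rewrite [RHS](_ : t = pi / 2 - (pi / 2 - t)); last by ring.
apply: (@FTC_0y R (fun y => r * sin t / sqdist r t y) _ _ _ _ _ _ A B).
- by move=> y _; exact: is_derive_atan_poisson.
- by move=> y; apply: derivable_poisson => //; rewrite gtr0_norm.
- exact: poisson_integrable.
Qed.

(** Multiplied by [r], the claim reduces on either side of [r] to the monotonicity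
    of [y * y `^ (b - 1) = y `^ b]. The factor [y - r] compensates the
    concentration of the Poisson kernel at [r]. *)
Lemma powR_sub_le (R : realType) (b r y : R) : 0 < b < 1 -> 0 < r -> 0 < y ->
  `|y `^ (b - 1) - r `^ (b - 1)| * r <= `|y - r| * y `^ (b - 1).
Proof.
move=> /andP[b0 b1] r0 y0.
have E (x : R) : 0 < x -> x `^ b = x * x `^ (b - 1).
  by move=> x0; rewrite -[X in X * _]powRr1 ?(ltW x0)// -powRD_gt0// addrC subrK.
have anti (x z : R) : 0 < x -> x <= z -> z `^ (b - 1) <= x `^ (b - 1).
  move=> x0 xz; rewrite -opprB !powRN lef_pV2 ?posrE ?powR_gt0 ?(lt_le_trans x0 xz)//.
  by rewrite ge0_ler_powR ?nnegrE ?subr_ge0 ?(ltW b1) ?(ltW x0) ?(le_trans (ltW x0) xz).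
have mono (x z : R) : 0 < x -> x <= z -> x * x `^ (b - 1) <= z * z `^ (b - 1).
  move=> x0 xz; rewrite -!E ?(lt_le_trans x0 xz)//.
  by rewrite ge0_ler_powR ?nnegrE ?(ltW b0) ?(ltW x0) ?(le_trans (ltW x0) xz).
have [yr|/ltW ry] := leP y r.
  rewrite ger0_norm ?subr_ge0 ?anti// ler0_norm ?subr_le0//.
  by have := mono _ _ y0 yr; lra.
rewrite ler0_norm ?subr_le0 ?anti// ger0_norm ?subr_ge0//.
by have := mono _ _ r0 ry; lra.
Qed.

(** The inequality of arithmetic and geometric means for the two terms of
    [sqdist_split]. *)
Lemma sqdist_ge_sin (R : realType) (r t y : R) : 0 < r -> 0 < y ->
  `|y - r| * (y + r) * `|sin t| <= sqdist r t y.
Proof.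
move=> r0 y0; have D0 : 0 <= sqdist r t y by rewrite addr_ge0 ?sqr_ge0.
rewrite -ler_sqr ?nnegrE//; last by rewrite !mulr_ge0// ltW// addr_gt0.
rewrite !exprMn !real_normK ?num_real// -subr_ge0.
have -> : sin t ^+ 2 = (1 - cos t) * (1 + cos t).
  by apply: (addrI (cos t ^+ 2)); rewrite cos2Dsin2; ring.
rewrite sqdist_split; set c := cos t.
have -> : (((1 + c) * (y + r) ^+ 2 + (1 - c) * (y - r) ^+ 2) / 2) ^+ 2 -
    (y - r) ^+ 2 * (y + r) ^+ 2 * ((1 - c) * (1 + c)) =
    (((1 + c) * (y + r) ^+ 2 - (1 - c) * (y - r) ^+ 2) / 2) ^+ 2 by field.
exact: sqr_ge0.
Qed.

(** As [t] tends to [pi] the Poisson kernel [r * sin t / sqdist r t y] concentrates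
    at [y = r], where the other factor vanishes. By [powR_sub_le] and
    [sqdist_ge_sin] the product is bounded by [y `^ (b - 1) / (y + r)] uniformly
    in [t]. *)
Lemma poisson_defect_cvg (R : realType) (b r : R) (t : nat -> R) :
  0 < b < 1 -> 0 < r -> (forall n, 0 < t n < pi) ->
  t n @[n --> \oo] --> (pi : R) ->
  \int[leb]_(y in halfline)
     ((y `^ (b - 1) - r `^ (b - 1)) * (r * sin (t n) / sqdist r (t n) y))
  @[n --> \oo] --> (0 : R).
Proof.
move=> b01 r0 tn tpi.
pose f n y := (y `^ (b - 1) - r `^ (b - 1)) * (r * sin (t n) / sqdist r (t n) y).
have tnorm n : `|t n| < pi by have /andP[a1 a2] := tn n; rewrite gtr0_norm.
have mf n : measurable_fun (halfline : set R) (f n).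
  apply: derivable_measurable_0y => y y0.
  have := sqdist_gt0 r0 (ltW y0) (tnorm n) => D0.
  rewrite /f /sqdist in D0 *; derivable.
  by rewrite gt_eqF.
have fle n (y : R) : 0 < y -> `|f n y| <= y `^ (b - 1) * (y + r)^-1.
  move=> y0; have D0 := sqdist_gt0 r0 (ltW y0) (tnorm n).
  have s0 := sin_gt0_pi (tn n).
  have yr : 0 < y + r by rewrite addr_gt0.
  rewrite /f !normrM normfV (gtr0_norm D0) (gtr0_norm r0).
  rewrite -[r * _ / _]mulrA [_ * (r * _)]mulrA.
  apply: (le_trans (ler_wpM2r _ (powR_sub_le b01 r0 y0))).
    by rewrite divr_ge0// ltW.
  rewrite mulrAC mulrC ler_wpM2l ?powR_ge0// mulrA ler_pdivrMr// [leRHS]mulrC.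
  by rewrite ler_pdivlMr// mulrAC; exact: sqdist_ge_sin.
have fcvg (y : R) : 0 < y -> f n y @[n --> \oo] --> (0 : R).
  move=> y0; have [->|yr] := eqVneq y r.
    rewrite (_ : (fun n => f n r) = fun=> 0); first exact: cvg_cst.
    by apply/funext => n; rewrite /f subrr mul0r.
  pose g s := (y `^ (b - 1) - r `^ (b - 1)) * (r * sin s / sqdist r s y).
  have D0 : sqdist r pi y != 0.
    rewrite /sqdist cospi sinpi mulr0 expr0n/= addr0 mulrN1 expf_neq0//.
    by rewrite subr_eq0.
  have gpi : g pi = 0 by rewrite /g sinpi mulr0 mul0r mulr0.
  have dg : derivable g pi 1.
    by rewrite /g /sqdist in D0 *; derivable.
  have cg : g s @[s --> pi] --> g pi.
    by apply: differentiable_continuous; apply/derivable1_diffP.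
  by rewrite -gpi; exact: (cvg_comp _ _ tpi cg).
have inD (y : R) : halfline y -> 0 < y by rewrite /= in_itv/= andbT.
have dc : (\int[leb]_(y in halfline) (f n y)%:E)%E @[n --> \oo] -->
    (\int[leb]_(y in halfline) (cst 0 y))%E.
  apply: (@dominated_cvg _ _ R leb halfline (measurable_itv _)
    (fun n y => (f n y)%:E) _ (EFin \o (fun y => y `^ (b - 1) * (y + r)^-1))).
  - by move=> n; apply/measurable_EFinP; exact: mf.
  - by move=> y /inD y0; apply: cvg_EFin; [exact: nearW|exact: fcvg].
  - by [].
  - exact: integrable_stieltjes_cst.
  - by move=> n y /inD y0; rewrite lee_fin; exact: fle.
by rewrite integral0 in dc; exact: (fine_cvg dc).
Qed.

(** The imaginary part of the transform at [r e^(i t)] is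
    [- stieltjes_cst b r * sin ((1 - b) * t)]. On the other hand it is the integral
    of [y `^ (b - 1)] against the Poisson kernel, up to sign, and this kernel has
    total mass [t] and tends to a point mass [pi] at [r] when [t] tends to [pi].
    Comparing the two limits gives the constant. *)
Lemma stieltjes_cst_sin (R : realType) (b r : R) : 0 < b < 1 -> 0 < r ->
  stieltjes_cst b r * sin (b * pi) = pi * r `^ (b - 1).
Proof.
move=> b01 r0; pose t n : R := pi - n.+1%:R^-1.
have pi2 := @pi_ge2 R.
have tn n : 0 < t n < pi.
  have h1 : n.+1%:R^-1 <= 1 :> R by rewrite invf_le1// ler1n.
  have h2 : 0 < n.+1%:R^-1 :> R by rewrite invr_gt0.
  by move: h1 h2; rewrite /t; move: (_^-1) => x h1 h2; apply/andP; split; lra.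
have tpi : t n @[n --> \oo] --> (pi : R).
  rewrite -[X in _ --> X]subr0; apply: cvgB; first exact: cvg_cst.
  exact: cvg_harmonicD1.
have c1 := poisson_defect_cvg b01 r0 tn tpi.
pose g (s : R) := stieltjes_cst b r * sin ((1 - b) * s) - r `^ (b - 1) * s.
have E n : \int[leb]_(y in halfline)
     ((y `^ (b - 1) - r `^ (b - 1)) * (r * sin (t n) / sqdist r (t n) y)) = g (t n).
  have /andP[t0 tp] := tn n.
  have tnorm : `|t n| < pi by rewrite gtr0_norm.
  have i1 : leb.-integrable halfline
     (EFin \o (fun y => y `^ (b - 1) * (r * sin (t n) / sqdist r (t n) y))).
    have := integrable_rotRe (pi / 2) b01 r0 tnorm.
    rewrite /rotRe cos_pihalf sin_pihalf.
    apply: eq_integrable; first exact: measurable_itv.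
    by move=> y _ /=; rewrite mul0r mul1r add0r.
  rewrite /g -(stieltjes_Im b01 r0 tnorm)  -mulNr.
  rewrite -[X in _ = _ + _ * X](poisson_integral r0 (tn n)).
  rewrite -Rintegral_halflineZl; last exact: poisson_integrable.
  rewrite -Rintegral_halflineD//; last first.
    by apply: integrable_halflineZl; exact: poisson_integrable.
  by apply: eq_Rintegral => y _; rewrite mulrBl mulNr.
have c2 : g (t n) @[n --> \oo] --> g pi.
  apply: (cvg_comp _ _ tpi); apply: differentiable_continuous.
  by apply/derivable1_diffP; rewrite /g; derivable.
rewrite (eq_cvg _ _ E) in c1.
have : g pi = 0 by apply: (cvg_unique _ c2 c1); exact: Rhausdorff.
rewrite /g => /eqP; rewrite subr_eq0 => /eqP; rewrite [RHS]mulrC => <-.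
by congr (_ * _); rewrite mulrBl mul1r sinB sinpi cospi mul0r mulN1r add0r opprK.
Qed.

(** * Lagrange interpolation of a function with one pole *)

Definition lagrange_coef (F : fieldType) (l : nat) (s : 'I_l -> F) (z : F)
    (i : 'I_l) : F :=
  \prod_(k < l | k != i) ((z - s k) / (s i - s k)).

Lemma size_prod_deg1 (F : fieldType) (I : finType) (P : pred I)
    (f : I -> {poly F}) : (forall k, (size (f k) <= 2)%N) ->
  (size (\prod_(k | P k) f k)%R <= #|P|.+1)%N.
Proof.
move=> f2; rewrite -sum1_card.
elim/big_rec2: _ => [|k p m _ IH]; first by rewrite size_poly1.
apply: (leq_trans (size_polyMleq _ _)).
by rewrite -subn1 leq_subLR (leq_trans (leq_add (f2 k) IH))// !addnS.
Qed.

(** The difference of the two sides is a polynomial of size at most [l] in [z]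
    that vanishes at the [l] nodes. *)
Lemma lagrange_exact (F : fieldType) (l : nat) (s : 'I_l -> F) (p : {poly F})
    (z : F) : injective s -> (size p <= l)%N ->
  \sum_(i < l) p.[s i] * lagrange_coef s z i = p.[z].
Proof.
move=> sI szp.
pose L i : {poly F} := \prod_(k < l | k != i) ((s i - s k)^-1 *: ('X - (s k)%:P)).
have Lz i x : (L i).[x] = lagrange_coef s x i.
  rewrite horner_prod; apply: eq_bigr => k _.
  by rewrite hornerZ hornerXsubC mulrC.
have Ls i j : lagrange_coef s (s j) i = (i == j)%:R.
  have [->|ij] := eqVneq i j.
    apply: big1 => k kj; rewrite divff// subr_eq0.
    by apply: contra kj => /eqP/sI ->.
  by rewrite /lagrange_coef (bigD1 j) 1?eq_sym//= subrr mul0r mul0r.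
have szL i : (size (L i) <= l)%N.
  apply: (leq_trans (size_prod_deg1 _ _)) => [k|].
    by rewrite (leq_trans (size_scale_leq _ _))// size_XsubC.
  by rewrite cardC1 card_ord prednK// (leq_ltn_trans _ (ltn_ord i)).
pose q := \sum_(i < l) p.[s i] *: L i - p.
have qE x : q.[x] = \sum_(i < l) p.[s i] * lagrange_coef s x i - p.[x].
  rewrite /q hornerD hornerN horner_sum; congr (_ - _).
  by apply: eq_bigr => i _; rewrite hornerZ Lz.
suff q0 : q = 0 by apply/eqP; rewrite -subr_eq0 -qE q0 horner0.
apply: (@roots_geq_poly_eq0 _ q (codom s)).
- apply/allP => _ /codomP[j ->]; rewrite rootE qE (bigD1 j)//= Ls eqxx mulr1.
  rewrite big1 ?addr0 ?subrr// => i /negbTE ij; by rewrite Ls ij mulr0.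
- by rewrite /codom map_inj_uniq// enum_uniq.
- rewrite size_codom card_ord (leq_trans (size_polyD _ _))//.
  rewrite geq_max size_polyN szp andbT.
  apply: (leq_trans (size_sum _ _ _)); apply/bigmax_leqP => i _.
  exact: leq_trans (size_scale_leq _ _) (szL i).
Qed.

(** Interpolation error of [w |-> (- w) ^+ n / (y + w)]. The polynomial
    [(- w) ^+ n - y ^+ n * P w], where [P w] is the product of the
    [(s k - w) / (y + s k)], vanishes at [w = - y]; its quotient by [y + w] has size
    at most [l] and agrees with the function at the nodes, so it is the
    interpolating polynomial. *)
Lemma lagrange_pole (F : fieldType) (l n : nat) (s : 'I_l -> F) (y z : F) :
  injective s -> (n <= l)%N -> y + z != 0 -> (forall k, y + s k != 0) ->
  (- z) ^+ n / (y + z) -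
    \sum_(i < l) (- s i) ^+ n / (y + s i) * lagrange_coef s z i =
  (-1) ^+ l * (y ^+ n / (y + z) * \prod_(k < l) ((z - s k) / (y + s k))).
Proof.
move=> sI nl yz ys.
pose P : {poly F} := \prod_(k < l) ((y + s k)^-1 *: ((s k)%:P - 'X)).
have Pz x : P.[x] = \prod_(k < l) ((s k - x) / (y + s k)).
  rewrite horner_prod; apply: eq_bigr => k _.
  by rewrite hornerZ hornerD hornerC hornerN hornerX mulrC.
have szP : (size P <= l.+1)%N.
  rewrite -[l in (_ <= l.+1)%N]card_ord; apply: size_prod_deg1 => k.
  by rewrite (leq_trans (size_scale_leq _ _))// -size_polyN opprB size_XsubC.
pose Q := (- 'X) ^+ n - y ^+ n *: P : {poly F}.
have rQ : root Q (- y).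
  rewrite rootE /Q hornerD hornerN hornerZ horner_exp hornerN hornerX opprK Pz.
  rewrite big1 ?mulr1 ?subrr// => k _; by rewrite opprK addrC divff.
have [p Qp] := factor_theorem _ _ rQ.
have QE x : (- x) ^+ n - y ^+ n * P.[x] = p.[x] * (y + x).
  have := congr1 (horner^~ x) Qp; rewrite hornerM hornerXsubC opprK addrC => <-.
  by rewrite /Q hornerD hornerN hornerZ horner_exp hornerN hornerX.
have szp : (size p <= l)%N.
  have [->|p0] := eqVneq p 0; first by rewrite size_poly0.
  have szQ : (size Q <= l.+1)%N.
    rewrite (leq_trans (size_polyD _ _))// geq_max size_polyN.
    rewrite (leq_trans (size_scale_leq _ _))// andbT.
    rewrite (leq_trans (size_poly_exp_leq _ _))//.
    by rewrite size_polyN size_polyX mul1n.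
  move: szQ; rewrite Qp size_Mmonic ?monicXsubC// size_XsubC.
  by rewrite addn2.
have sE i : (- s i) ^+ n / (y + s i) = p.[s i].
  apply: (mulIf (ys i)); rewrite -QE divfK// Pz (bigD1 i)//= subrr mul0r mul0r.
  by rewrite mulr0 subr0.
under eq_bigr do rewrite sE.
rewrite (lagrange_exact _ sI szp).
have -> : p.[z] = ((- z) ^+ n - y ^+ n * P.[z]) / (y + z) by rewrite QE mulfK.
rewrite -mulrBl opprB addrC subrK Pz.
under eq_bigr do rewrite -opprB mulNr.
by rewrite prodrN card_ord; ring.
Qed.

(** * The complex exponential and powers *)

Lemma complex_eq (R : realType) (x y : R[i]) :
  complex.Re x = complex.Re y -> complex.Im x = complex.Im y -> x = y.
Proof. by case: x => a b; case: y => c d /= -> ->. Qed.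

Lemma cReD (R : realType) (x y : R[i]) :
  complex.Re (x + y) = complex.Re x + complex.Re y.
Proof. by case: x; case: y. Qed.

Lemma cImD (R : realType) (x y : R[i]) :
  complex.Im (x + y) = complex.Im x + complex.Im y.
Proof. by case: x; case: y. Qed.

Lemma cReM (R : realType) (x y : R[i]) : complex.Re (x * y) =
  complex.Re x * complex.Re y - complex.Im x * complex.Im y.
Proof. by case: x; case: y. Qed.

Lemma cImM (R : realType) (x y : R[i]) : complex.Im (x * y) =
  complex.Re x * complex.Im y + complex.Im x * complex.Re y.
Proof. by case: x; case: y. Qed.

Lemma cReZ (R : realType) (a : R) (x : R[i]) :
  complex.Re (a%:C * x) = a * complex.Re x.
Proof. by rewrite cReM /= mul0r subr0. Qed.

Lemma cImZ (R : realType) (a : R) (x : R[i]) :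
  complex.Im (a%:C * x) = a * complex.Im x.
Proof. by rewrite cImM /= mul0r addr0. Qed.

Lemma cexpD (R : realType) (x y : R[i]) : cexp (x + y) = cexp x * cexp y.
Proof.
apply: complex_eq; rewrite /cexp ?(cReZ, cImZ) cReD cImD /= expRD ?cosD ?sinD;
  rewrite ?(cReM, cImM) ?(cReZ, cImZ) /=; ring.
Qed.

Lemma cexp0 (R : realType) : cexp (0 : R[i]) = 1.
Proof. by rewrite /cexp /= expR0 cos0 sin0 mul1r. Qed.

Lemma normc_gt0 (R : realType) (w : R[i]) : w != 0 -> 0 < Normc.normc w.
Proof.
move=> w0; rewrite lt_neqAle eq_sym; apply/andP; split.
  by apply: contra w0 => /eqP/Normc.eq0_normc ->.
by case: w {w0} => a b /=; exact: sqrtr_ge0.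
Qed.

Lemma normc_sqr (R : realType) (w : R[i]) :
  Normc.normc w ^+ 2 = complex.Re w ^+ 2 + complex.Im w ^+ 2.
Proof. by case: w => a b /=; rewrite sqr_sqrtr// addr_ge0 ?sqr_ge0. Qed.

Lemma Re_over_normc (R : realType) (w : R[i]) : w != 0 ->
  -1 <= complex.Re w / Normc.normc w <= 1.
Proof.
move=> /normc_gt0 w0; rewrite -ler_norml normrM normfV (gtr0_norm w0).
rewrite ler_pdivrMr// mul1r -[leRHS](gtr0_norm w0) -ler_sqr ?nnegrE//.
by rewrite !real_normK ?num_real// normc_sqr lerDl sqr_ge0.
Qed.

Lemma Re_carg (R : realType) (w : R[i]) : w != 0 ->
  complex.Re w = Normc.normc w * cos (carg w).
Proof.
move=> w0; have r0 := normc_gt0 w0; rewrite /carg.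
case: ifP => _; rewrite ?cosN acosK ?in_itv/= ?Re_over_normc//;
  by rewrite mulrC divfK// gt_eqF.
Qed.

Lemma Im_carg (R : realType) (w : R[i]) : w != 0 ->
  complex.Im w = Normc.normc w * sin (carg w).
Proof.
move=> w0; have r0 := normc_gt0 w0.
have E : `|complex.Im w| =
    Normc.normc w * Num.sqrt (1 - (complex.Re w / Normc.normc w) ^+ 2).
  rewrite -sqrtr_sqr -[X in X * _](ger0_norm (ltW r0)) -sqrtr_sqr -sqrtrM ?sqr_ge0//.
  congr Num.sqrt; rewrite mulrBr mulr1 exprMn mulrCA exprVn divff ?expf_neq0 ?gt_eqF//.
  by rewrite mulr1 normc_sqr [X in _ = X - _]addrC addrK.
rewrite /carg; case: ifPn => [Im0|].
  by rewrite sin_acos ?Re_over_normc// -E ger0_norm.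
rewrite -ltNge => Im0; rewrite sinN sin_acos ?Re_over_normc// mulrN -E.
by rewrite ltr0_norm// opprK.
Qed.

Lemma cexp_clog (R : realType) (w : R[i]) : w != 0 -> cexp (clog w) = w.
Proof.
move=> w0; have r0 := normc_gt0 w0; rewrite /cexp /clog /= lnK ?posrE//.
by apply: complex_eq; rewrite ?(cReZ, cImZ) /= -?Re_carg -?Im_carg.
Qed.

(** The argument has absolute value [pi] only when the real part is minus the
    modulus, which forces the imaginary part to vanish. *)
Lemma carg_lt_pi (R : realType) (w : R[i]) :
  ~ [set x%:C | x in `]-oo, (0 : R)]] w -> `|carg w| < pi.
Proof.
move=> wN; have w0 : w != 0.
  by apply/eqP => w0; apply: wN; exists 0 => //=; rewrite in_itv/= lexx.
have /andP[x1 x2] := Re_over_normc w0; have r0 := normc_gt0 w0.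
have -> : `|carg w| = acos (complex.Re w / Normc.normc w).
  have ge0 := @acos_ge0 R (complex.Re w / Normc.normc w).
  by rewrite /carg; case: ifP => _; rewrite ?normrN ger0_norm// ge0// x1.
apply: acos_ltpi; rewrite x2 andbT lt_neqAle x1 andbT; apply/eqP => E.
have ReE : complex.Re w = - Normc.normc w.
  by rewrite -[LHS](divfK (lt0r_neq0 r0)) -E mulN1r.
have : complex.Im w = 0.
  have := normc_sqr w; rewrite ReE sqrrN => /eqP.
  by rewrite addrC -subr_eq subrr eq_sym sqrf_eq0 => /eqP.
move=> ImE; apply: wN; exists (complex.Re w).
  by rewrite /= in_itv/= ReE oppr_le0 ltW.
by apply: complex_eq.
Qed.

Lemma cpowE (R : realType) (w : R[i]) (a : R) : w != 0 ->
  cpow w a = cexp (a%:C * clog w).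
Proof. by rewrite /cpow => /negbTE ->. Qed.

Lemma cpowD (R : realType) (w : R[i]) (a b : R) : w != 0 ->
  cpow w (a + b) = cpow w a * cpow w b.
Proof. by move=> w0; rewrite !cpowE// -cexpD -mulrDl rmorphD. Qed.

Lemma cpow1 (R : realType) (w : R[i]) : w != 0 -> cpow w 1 = w.
Proof. by move=> w0; rewrite cpowE// mul1r cexp_clog. Qed.

Lemma cpow_nat (R : realType) (w : R[i]) (n : nat) : w != 0 ->
  cpow w n%:R = w ^+ n.
Proof.
move=> w0; elim: n => [|n IH].
  by rewrite cpowE// mul0r cexp0 expr0.
by rewrite -natr1 cpowD// IH cpow1// exprSr.
Qed.

Lemma cpow_polar (R : realType) (w : R[i]) (a : R) : w != 0 ->
  cpow w a = (Normc.normc w `^ a)%:C *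
    (cos (a * carg w) +i* sin (a * carg w)).
Proof.
move=> w0; rewrite cpowE// /cexp /clog cReZ cImZ /powR gt_eqF//.
exact: normc_gt0.
Qed.

(** * Integrals of complex-valued functions on the half-line *)

Lemma eq_cintegrable (R : realType) (f g : R -> R[i]) :
  (forall y, 0 < y -> f y = g y) -> cintegrable f -> cintegrable g.
Proof.
move=> fg [f1 f2]; split; [apply: eq_integrable f1|apply: eq_integrable f2];
  try exact: measurable_itv;
  by move=> y; rewrite inE/= in_itv/= andbT => y0; rewrite fg.
Qed.

Lemma eq_cintegral (R : realType) (f g : R -> R[i]) :
  (forall y, 0 < y -> f y = g y) -> cintegral f = cintegral g.
Proof.
move=> fg; rewrite /cintegral; congr (_ +i* _); apply: eq_Rintegral => y;
  by rewrite inE/= in_itv/= andbT => y0; rewrite fg.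
Qed.

Lemma cintegrableD (R : realType) (f g : R -> R[i]) :
  cintegrable f -> cintegrable g -> cintegrable (fun y => f y + g y).
Proof.
move=> [f1 f2] [g1 g2]; split.
  apply: eq_integrable (integrable_halflineD f1 g1); first exact: measurable_itv.
  by move=> y _; rewrite /= cReD.
apply: eq_integrable (integrable_halflineD f2 g2); first exact: measurable_itv.
by move=> y _; rewrite /= cImD.
Qed.

Lemma cintegralD (R : realType) (f g : R -> R[i]) :
  cintegrable f -> cintegrable g ->
  cintegral (fun y => f y + g y) = cintegral f + cintegral g.
Proof.
move=> [f1 f2] [g1 g2]; apply: complex_eq; rewrite /cintegral ?(cReD, cImD) /=.
  by rewrite -Rintegral_halflineD//; apply: eq_Rintegral => y _; rewrite cReD.
by rewrite -Rintegral_halflineD//; apply: eq_Rintegral => y _; rewrite cImD.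
Qed.

Lemma cintegrableZ (R : realType) (c : R[i]) (f : R -> R[i]) :
  cintegrable f -> cintegrable (fun y => c * f y).
Proof.
move=> [f1 f2]; split.
  apply: eq_integrable (integrable_halflineD
    (integrable_halflineZl (complex.Re c) f1)
    (integrable_halflineZl (- complex.Im c) f2)); first exact: measurable_itv.
  by move=> y _; rewrite /= cReM mulNr.
apply: eq_integrable (integrable_halflineD
    (integrable_halflineZl (complex.Re c) f2)
    (integrable_halflineZl (complex.Im c) f1)); first exact: measurable_itv.
by move=> y _; rewrite /= cImM.
Qed.

Lemma cintegralZ (R : realType) (c : R[i]) (f : R -> R[i]) :
  cintegrable f -> cintegral (fun y => c * f y) = c * cintegral f.
Proof.
move=> [f1 f2]; apply: complex_eq; rewrite ?(cReM, cImM) /=.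
  rewrite -mulNr -!Rintegral_halflineZl// -Rintegral_halflineD;
    [|exact: integrable_halflineZl..].
  by apply: eq_Rintegral => y _; rewrite cReM mulNr.
rewrite -!Rintegral_halflineZl// -Rintegral_halflineD;
  [|exact: integrable_halflineZl..].
by apply: eq_Rintegral => y _; rewrite cImM.
Qed.

Lemma cintegrable0 (R : realType) : cintegrable (fun=> 0 : R[i]).
Proof. by split; apply: integrable0. Qed.

Lemma cintegral0 (R : realType) : cintegral (fun=> 0 : R[i]) = 0.
Proof.
rewrite /cintegral /Rintegral /=.
by rewrite integral0.
Qed.

(** Integrability and value are proved together since additivity of the integral
    uses the integrability of the partial sums. *)
Lemma cintegrable_sum (R : realType) (I : finType) (f : I -> R -> R[i]) :
  (forall i, cintegrable (f i)) ->
  cintegrable (fun y => \sum_i f i y) /\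
  cintegral (fun y => \sum_i f i y) = \sum_i cintegral (f i).
Proof.
move=> fi; rewrite -big_enum /=.
suff H (s : seq I) : cintegrable (fun y => \sum_(i <- s) f i y) /\
    cintegral (fun y => \sum_(i <- s) f i y) = \sum_(i <- s) cintegral (f i).
  have [] := H (enum I); rewrite big_enum => A B; split.
    by apply: eq_cintegrable A => y _; rewrite big_enum.
  by rewrite -B; apply: eq_cintegral => y _; rewrite big_enum.
elim: s => [|i s [IH1 IH2]].
  rewrite big_nil; split.
    by apply: eq_cintegrable (cintegrable0 R) => y _; rewrite big_nil.
  by rewrite -[RHS](cintegral0 R); apply: eq_cintegral => y _; rewrite big_nil.
rewrite big_cons -IH2 -cintegralD//; split.
  by apply: eq_cintegrable (cintegrableD (fi i) IH1) => y _; rewrite big_cons.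
by apply: eq_cintegral => y _; rewrite big_cons.
Qed.

(** * The Stieltjes transform of a power *)

Lemma slit_neq0 (R : realType) (w : R[i]) : ~ negreals R w -> w != 0.
Proof.
move=> wN; apply/eqP => w0; apply: wN; exists 0 => //=.
by rewrite in_itv/= lexx.
Qed.

Lemma sqdist_polar (R : realType) (w : R[i]) (y : R) : w != 0 ->
  sqdist (Normc.normc w) (carg w) y =
    (y + complex.Re w) ^+ 2 + complex.Im w ^+ 2.
Proof. by move=> w0; rewrite /sqdist -Re_carg// -Im_carg. Qed.

Lemma Re_inv_shift (R : realType) (w : R[i]) (y : R) : w != 0 ->
  complex.Re (y%:C + w)^-1 =
    (y + complex.Re w) / sqdist (Normc.normc w) (carg w) y.
Proof. by move=> w0; rewrite sqdist_polar//; case: w w0 => u v _ /=; rewrite add0r. Qed.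

Lemma Im_inv_shift (R : realType) (w : R[i]) (y : R) : w != 0 ->
  complex.Im (y%:C + w)^-1 =
    - (complex.Im w / sqdist (Normc.normc w) (carg w) y).
Proof. by move=> w0; rewrite sqdist_polar//; case: w w0 => u v _ /=; rewrite add0r. Qed.

Lemma shift_neq0 (R : realType) (w : R[i]) (y : R) : ~ negreals R w -> 0 < y ->
  y%:C + w != 0.
Proof.
move=> wN y0; apply/eqP => E; apply: wN; exists (- y).
  by rewrite /= in_itv/= oppr_le0 ltW.
by apply/eqP; rewrite rmorphN/= -subr_eq0 -opprD oppr_eq0 E.
Qed.

(** Real and imaginary part are [rotRe] with the phases [0] and [pi / 2], up to the
    sign of the latter. *)
Lemma stieltjes_transform (R : realType) (b : R) (w : R[i]) :
  0 < b < 1 -> ~ negreals R w ->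
  cintegrable (fun y => (y `^ (b - 1))%:C * (y%:C + w)^-1) /\
  cintegral (fun y => (y `^ (b - 1))%:C * (y%:C + w)^-1) =
    (pi / sin (b * pi))%:C * cpow w (b - 1).
Proof.
move=> b01 wN; have w0 := slit_neq0 wN; have r0 := normc_gt0 w0.
have tpi := carg_lt_pi wN.
have sb0 : 0 < sin (b * pi).
  have /andP[b0 b1] := b01; apply: sin_gt0_pi.
  by rewrite mulr_gt0 ?pi_gt0//= gtr_pMl// pi_gt0.
have iRe : leb.-integrable halfline (EFin \o (fun y => y `^ (b - 1) *
    ((y + complex.Re w) / sqdist (Normc.normc w) (carg w) y))).
  apply: eq_integrable (integrable_rotRe 0 b01 r0 tpi); first exact: measurable_itv.
  by move=> y _; rewrite /= /rotRe cos0 sin0 mul1r mul0r addr0 -Re_carg.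
have iIm : leb.-integrable halfline (EFin \o (fun y => y `^ (b - 1) *
    (complex.Im w / sqdist (Normc.normc w) (carg w) y))).
  apply: eq_integrable (integrable_rotRe (pi / 2) b01 r0 tpi).
    exact: measurable_itv.
  by move=> y _; rewrite /= /rotRe cos_pihalf sin_pihalf mul1r mul0r add0r -Im_carg.
split.
  split.
    apply: eq_integrable iRe; first exact: measurable_itv.
    by move=> y _; rewrite /= cReZ Re_inv_shift.
  apply: eq_integrable (integrable_halflineZl (-1) iIm); first exact: measurable_itv.
  by move=> y _; rewrite /= cImZ Im_inv_shift// mulN1r mulrN.
have CE : stieltjes_cst b (Normc.normc w) =
    pi / sin (b * pi) * Normc.normc w `^ (b - 1).
  by rewrite mulrAC -(stieltjes_cst_sin b01 r0) mulfK// gt_eqF.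
have cE : cos ((b - 1) * carg w) = cos ((1 - b) * carg w).
  by rewrite -cosN -mulNr opprB.
have sE : sin ((b - 1) * carg w) = - sin ((1 - b) * carg w).
  by rewrite -sinN -mulNr opprB.
rewrite cpow_polar// mulrA -rmorphM/= -CE.
apply: complex_eq; rewrite ?(cReZ, cImZ) /= ?cE ?sE.
  rewrite -(stieltjes_Re b01 r0 tpi); apply: eq_Rintegral => y _.
  by rewrite cReZ Re_inv_shift// -Re_carg.
rewrite mulrN -(stieltjes_Im b01 r0 tpi) -[RHS]mulN1r -Im_carg//.
rewrite -Rintegral_halflineZl//; apply: eq_Rintegral => y _.
by rewrite cImZ Im_inv_shift// mulN1r mulrN.
Qed.

(** * Functions decaying like a power at infinity *)

(** The bound makes [y `^ (a - 1) * h y] integrable for all [a] between 0 and [m].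
    The exponents [m] add up under products, which is how the product over the
    nodes is estimated. *)
Definition decays (R : realType) (m : nat) (h : R -> R[i]) : Prop :=
  [/\ measurable_fun (halfline : set R) (fun y => complex.Re (h y)),
      measurable_fun (halfline : set R) (fun y => complex.Im (h y)) &
      exists K, forall y : R, 0 < y ->
        Normc.normc (h y) <= K / (1 + y) ^+ m].

Lemma Re_le_normc (R : realType) (w : R[i]) : `|complex.Re w| <= Normc.normc w.
Proof.
have n0 : 0 <= Normc.normc w by case: w => a b; exact: sqrtr_ge0.
rewrite -[leRHS](ger0_norm n0) -ler_sqr ?nnegrE// !real_normK ?num_real//.
by rewrite normc_sqr lerDl sqr_ge0.
Qed.

Lemma Im_le_normc (R : realType) (w : R[i]) : `|complex.Im w| <= Normc.normc w.
Proof.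
have n0 : 0 <= Normc.normc w by case: w => a b; exact: sqrtr_ge0.
rewrite -[leRHS](ger0_norm n0) -ler_sqr ?nnegrE// !real_normK ?num_real//.
by rewrite normc_sqr lerDr sqr_ge0.
Qed.

Lemma decays_cst (R : realType) (c : R[i]) : decays 0 (fun=> c).
Proof.
split; [exact: measurable_cst..|].
by exists (Normc.normc c) => y _; rewrite expr0 divr1.
Qed.

Lemma decaysM (R : realType) (m n : nat) (g h : R -> R[i]) :
  decays m g -> decays n h -> decays (m + n) (fun y => g y * h y).
Proof.
move=> [g1 g2 [K gK]] [h1 h2 [L hL]]; split.
- have -> : (fun y => complex.Re (g y * h y)) = (fun y =>
      complex.Re (g y) * complex.Re (h y) - complex.Im (g y) * complex.Im (h y)).
    by apply/funext => y; rewrite cReM.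
  by apply: measurable_funB; apply: measurable_funM.
- have -> : (fun y => complex.Im (g y * h y)) = (fun y =>
      complex.Re (g y) * complex.Im (h y) + complex.Im (g y) * complex.Re (h y)).
    by apply/funext => y; rewrite cImM.
  by apply: measurable_funD; apply: measurable_funM.
- exists (K * L) => y y0; rewrite Normc.normcM exprD invfM mulrACA.
  have n0 (w : R[i]) : 0 <= Normc.normc w by case: w => a b; exact: sqrtr_ge0.
  by apply: ler_pM; rewrite ?gK ?hL.
Qed.

Lemma decays_inv_shift (R : realType) (w : R[i]) : ~ negreals R w ->
  decays 1 (fun y => (y%:C + w)^-1).
Proof.
move=> wN; have w0 := slit_neq0 wN; have r0 := normc_gt0 w0.
have tpi := carg_lt_pi wN; have k0 := cos_gtN1 tpi.
split.
- have -> : (fun y => complex.Re (y%:C + w)^-1) = (fun y =>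
      (y + complex.Re w) / sqdist (Normc.normc w) (carg w) y).
    by apply/funext => y; rewrite Re_inv_shift.
  apply: derivable_measurable_div => y y0; rewrite ?/sqdist; [derivable..|].
  by rewrite gt_eqF//; have := sqdist_gt0 r0 (ltW y0) tpi.
- have -> : (fun y => complex.Im (y%:C + w)^-1) = (fun y =>
      - complex.Im w / sqdist (Normc.normc w) (carg w) y).
    by apply/funext => y; rewrite Im_inv_shift// mulNr.
  apply: derivable_measurable_div => y y0; rewrite ?/sqdist; [derivable..|].
  by rewrite gt_eqF//; have := sqdist_gt0 r0 (ltW y0) tpi.
- set k := (1 + cos (carg w)) / 2.
  have kk : 0 < Num.sqrt k by rewrite sqrtr_gt0.
  exists ((Num.sqrt k)^-1 / Num.min 1 (Normc.normc w)) => y y0.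
  rewrite Normc.normcV; apply: (le_trans _ (inv_shift_le r0 (ltW y0) _));
    last by rewrite invr_ge0 ltW.
  have yr : 0 < y + Normc.normc w by rewrite addr_gt0.
  rewrite -invfM lef_pV2 ?posrE ?mulr_gt0//; last first.
    by apply: normc_gt0; exact: shift_neq0.
  have n0 : 0 <= Normc.normc (y%:C + w).
    by case: (_ + _) => a b; exact: sqrtr_ge0.
  rewrite -ler_sqr ?nnegrE ?mulr_ge0 ?(ltW yr) ?(ltW kk)//.
  rewrite exprMn sqr_sqrtr ?(ltW k0)// normc_sqr cReD cImD /= add0r.
  by rewrite -sqdist_polar//; exact: sqdist_ge.
Qed.

Lemma decays_prod (R : realType) (I : Type) (s : seq I) (h : I -> R -> R[i]) :
  (forall i, decays 1 (h i)) ->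
  decays (size s) (fun y => \prod_(i <- s) h i y).
Proof.
move=> hi; elim: s => [|i s IH].
  have -> : (fun y => \prod_(i <- [::]) h i y) = fun=> 1.
    by apply/funext => y; rewrite big_nil.
  exact: decays_cst.
have -> : (fun y => \prod_(j <- i :: s) h j y) =
    (fun y => h i y * \prod_(j <- s) h j y).
  by apply/funext => y; rewrite big_cons.
exact: (decaysM (hi i) IH).
Qed.

Lemma decays_node_prod (R : realType) (l : nat) (s : 'I_l -> R[i]) (z : R[i]) :
  (forall k, ~ negreals R (s k)) -> decays l (node_prod s z).
Proof.
move=> sN; rewrite -[l in decays l _]size_enum_ord.
have -> : node_prod s z =
    (fun y => \prod_(k <- enum 'I_l) ((z - s k) * (y%:C + s k)^-1)).
  by apply/funext => y; rewrite big_enum.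
apply: decays_prod => k.
exact: (decaysM (decays_cst (z - s k)) (decays_inv_shift (sN k))).
Qed.

(** * Differentiation with respect to a real parameter *)

(** Derivative of a complex-valued function of a real variable, taken
    componentwise like the integrals. *)
Definition is_cderive (R : realType) (x : R) (f : R -> R[i]) (l : R[i]) : Prop :=
  is_derive x 1 (fun t => complex.Re (f t)) (complex.Re l) /\
  is_derive x 1 (fun t => complex.Im (f t)) (complex.Im l).

Lemma is_cderive_unique (R : realType) (x u v : R) (f g : R -> R[i]) (p q : R[i]) :
  x \in `]u, v[ -> (forall t, t \in `]u, v[ -> f t = g t) ->
  is_cderive x f p -> is_cderive x g q -> p = q.
Proof.
move=> xuv fg [f1 f2] [g1 g2].
have nfg : \forall t \near x, f t = g t.
  by have := near_in_itvoo xuv; apply: filterS => t; exact: fg.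
apply: complex_eq.
  rewrite -(derive_val (is_derive := f1)) -(derive_val (is_derive := g1)).
  by apply: near_eq_derive => //; apply: filterS nfg => t ->.
rewrite -(derive_val (is_derive := f2)) -(derive_val (is_derive := g2)).
by apply: near_eq_derive => //; apply: filterS nfg => t ->.
Qed.

Lemma is_cderiveD (R : realType) (x : R) (f g : R -> R[i]) (p q : R[i]) :
  is_cderive x f p -> is_cderive x g q ->
  is_cderive x (fun t => f t + g t) (p + q).
Proof.
move=> [f1 f2] [g1 g2]; split.
  by under eq_fun do rewrite cReD; rewrite cReD; apply: is_derive1D.
by under eq_fun do rewrite cImD; rewrite cImD; apply: is_derive1D.
Qed.

Lemma is_cderiveM (R : realType) (x : R) (f g : R -> R[i]) (p q : R[i]) :
  is_cderive x f p -> is_cderive x g q ->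
  is_cderive x (fun t => f t * g t) (p * g x + f x * q).
Proof.
move=> [f1 f2] [g1 g2]; split.
  under eq_fun do rewrite cReM.
  by derive; rewrite cReD !cReM; ring.
under eq_fun do rewrite cImM.
by derive; rewrite cImD !cImM; ring.
Qed.

Lemma is_cderive_cst (R : realType) (x : R) (c : R[i]) :
  is_cderive x (fun=> c) 0.
Proof. by split; apply: is_derive1_cst. Qed.

Lemma is_cderive_real (R : realType) (x d : R) (f : R -> R) :
  is_derive x 1 f d -> is_cderive x (fun t => (f t)%:C) d%:C.
Proof. by move=> df; split => //=; apply: is_derive1_cst. Qed.

Lemma is_cderiveMl (R : realType) (x : R) (c : R[i]) (f : R -> R[i]) (p : R[i]) :
  is_cderive x f p -> is_cderive x (fun t => c * f t) (c * p).
Proof.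
move=> fp; have := is_cderiveM (is_cderive_cst x c) fp.
by rewrite mul0r add0r.
Qed.

Lemma is_cderive_sum (R : realType) (x : R) (I : finType) (f : I -> R -> R[i])
    (p : I -> R[i]) : (forall i, is_cderive x (f i) (p i)) ->
  is_cderive x (fun t => \sum_i f i t) (\sum_i p i).
Proof.
move=> fp; rewrite -big_enum.
have -> : (fun t => \sum_i f i t) = (fun t => \sum_(i <- enum I) f i t).
  by apply/funext => t; rewrite big_enum.
elim: (enum I) => [|i s IH].
  by rewrite big_nil; under eq_fun do rewrite big_nil; exact: is_cderive_cst.
rewrite big_cons; under eq_fun do rewrite big_cons.
exact: is_cderiveD.
Qed.

Lemma is_cderive_cpow (R : realType) (a c : R) (w : R[i]) : w != 0 ->
  is_cderive a (fun t => cpow w (t + c)) (cpow w (a + c) * clog w).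
Proof.
move=> w0.
have E t : cpow w t = cexp (t%:C * clog w) by exact: cpowE.
have RE t : complex.Re (cpow w t) =
    expR (t * complex.Re (clog w)) * cos (t * complex.Im (clog w)).
  by rewrite E /cexp !cReZ cImZ.
have IE t : complex.Im (cpow w t) =
    expR (t * complex.Re (clog w)) * sin (t * complex.Im (clog w)).
  by rewrite E /cexp !cImZ cReZ.
split.
  rewrite cReM RE IE; under eq_fun do rewrite RE.
  by derive; rewrite /=; ring.
rewrite cImM RE IE; under eq_fun do rewrite IE.
by derive; rewrite /=; ring.
Qed.

Lemma Mellin_decays (R : realType) (m : nat) (h : R -> R[i]) (a : R) :
  decays m h -> 0 < a < m%:R ->
  [/\ cintegrable (fun y => (y `^ (a - 1))%:C * h y),
      cintegrable (fun y => (y `^ (a - 1) * ln y)%:C * h y) &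
      is_cderive a (fun a => cintegral (fun y => (y `^ (a - 1))%:C * h y))
        (cintegral (fun y => (y `^ (a - 1) * ln y)%:C * h y))].
Proof.
move=> [h1 h2 [K hK]] am.
have RK (y : R) : 0 < y -> `|complex.Re (h y)| <= K / (1 + y) ^+ m.
  by move=> y0; apply: le_trans (hK y y0); exact: Re_le_normc.
have IK (y : R) : 0 < y -> `|complex.Im (h y)| <= K / (1 + y) ^+ m.
  by move=> y0; apply: le_trans (hK y y0); exact: Im_le_normc.
have mD : forall f g : R -> R, (forall y, f y = g y) ->
    leb.-integrable halfline (EFin \o f) -> leb.-integrable halfline (EFin \o g).
  by move=> f g fg; apply: eq_integrable => [|y _ /=];
    [exact: measurable_itv|rewrite fg].
split.
- split.
    by apply: mD (integrable_powR_mul h1 RK am) => y; rewrite cReZ.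
  by apply: mD (integrable_powR_mul h2 IK am) => y; rewrite cImZ.
- split.
    by apply: mD (integrable_powR_ln_mul h1 RK am) => y; rewrite cReZ.
  by apply: mD (integrable_powR_ln_mul h2 IK am) => y; rewrite cImZ.
- split; rewrite /cintegral /=.
    have := is_derive_Mellin h1 RK am.
    have E (f g : R -> R) : f =1 g ->
       \int[leb]_(y in halfline) f y = \int[leb]_(y in halfline) g y.
      by move=> fg; congr Rintegral; apply/funext.
    under [X in is_derive _ _ X _]eq_fun do under eq_Rintegral do rewrite -cReZ.
    by under [X in is_derive _ _ _ X]eq_Rintegral do rewrite -cReZ.
  have := is_derive_Mellin h2 IK am.
  under [X in is_derive _ _ X _]eq_fun do under eq_Rintegral do rewrite -cImZ.
  by under [X in is_derive _ _ _ X]eq_Rintegral do rewrite -cImZ.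
Qed.

(** * The interpolation formulas *)

(** Both integrands are a power of [y], with a logarithm for the second one, times
    this function, which depends neither on the exponent nor on the logarithm. *)
Definition kernel_factor (R : realType) (l : nat) (s : 'I_l -> R[i]) (z : R[i])
    (y : R) : R[i] := z * (y%:C + z)^-1 * node_prod s z y.

Lemma decays_kernel_factor (R : realType) (l : nat) (s : 'I_l -> R[i]) (z : R[i]) :
  (forall k, ~ negreals R (s k)) -> ~ negreals R z ->
  decays l.+1 (kernel_factor s z).
Proof.
move=> sN zN; rewrite -[l.+1]/((0 + 1) + l)%N.
apply: decaysM; last exact: decays_node_prod.
by apply: decaysM; [exact: decays_cst|exact: decays_inv_shift].
Qed.

Lemma pow_kernelE (R : realType) (l : nat) (s : 'I_l -> R[i]) (z : R[i]) (a y : R) :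
  pow_kernel a z y * node_prod s z y = (y `^ (a - 1))%:C * kernel_factor s z y.
Proof. by rewrite /pow_kernel /kernel_factor; ring. Qed.

Lemma log_kernelE (R : realType) (l : nat) (s : 'I_l -> R[i]) (z : R[i]) (a y : R) :
  log_kernel a z y * node_prod s z y =
  (y `^ (a - 1) * ln y)%:C * kernel_factor s z y.
Proof. by rewrite /log_kernel /kernel_factor rmorphM; ring. Qed.

Lemma sin_natD_pi (R : realType) (n : nat) (b : R) :
  sin ((n%:R + b) * pi) = (-1) ^+ n * sin (b * pi).
Proof.
elim: n => [|n IH]; first by rewrite add0r expr0 mul1r.
have -> : (n.+1%:R + b) * pi = (n%:R + b) * pi + pi by rewrite -natr1; ring.
by rewrite sinDpi IH exprS mulN1r mulNr.
Qed.

(** Writing [a = n + b], the power [y ^+ n] is absorbed by [lagrange_pole], and the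
    integrand becomes a combination of kernels [y `^ (b - 1) / (y + w)], where [w]
    is [z] or a node. Each of them is integrable for [0 < b < 1], whereas the
    partial fractions of the original integrand are not when [n] is positive. *)
Lemma kernel_factor_expand (R : realType) (l n : nat) (s : 'I_l -> R[i])
    (z : R[i]) (b y : R) :
  injective s -> (n <= l)%N -> (forall k, ~ negreals R (s k)) -> ~ negreals R z ->
  0 < y ->
  (y `^ (n%:R + b - 1))%:C * kernel_factor s z y =
  (-1) ^+ l * z * ((- z) ^+ n * ((y `^ (b - 1))%:C * (y%:C + z)^-1) +
    \sum_i (- ((- s i) ^+ n * lagrange_coef s z i)) *
      ((y `^ (b - 1))%:C * (y%:C + s i)^-1)).
Proof.
move=> sI nl sN zN y0.
have pE : (y `^ (n%:R + b - 1))%:C = y%:C ^+ n * (y `^ (b - 1))%:C.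
  by rewrite -addrA (powRD_gt0 n%:R)// powR_mulrn ?(ltW y0)// rmorphM/= rmorphXn.
have := lagrange_pole sI nl (shift_neq0 zN y0) (fun k => shift_neq0 (sN k) y0).
set S := \sum_i _ => E.
have -> : \sum_i (- ((- s i) ^+ n * lagrange_coef s z i)) *
      ((y `^ (b - 1))%:C * (y%:C + s i)^-1) = - (y `^ (b - 1))%:C * S.
  rewrite /S big_distrr/=; apply: eq_bigr => i _; ring.
have sgn : (-1) ^+ l * (-1) ^+ l = 1 :> R[i] by rewrite -exprMn mulN1r opprK expr1n.
transitivity ((-1) ^+ l * z * (y `^ (b - 1))%:C * ((- z) ^+ n / (y%:C + z) - S));
  last by ring.
rewrite E pE /kernel_factor /node_prod -[LHS]mul1r -{1}sgn; ring.
Qed.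

(** If [a] is an integer, the sine vanishes and [w ^+ (a - 1)] is a polynomial
    reproduced by interpolation. Otherwise every kernel in [kernel_factor_expand]
    integrates to [pi / sin (b * pi)] times a power, and the terms of the nodes add
    up to the interpolating polynomial. *)
Lemma interp_formula (R : realType) (a : R) (l : nat) (s : 'I_l -> R[i]) (z : R[i]) :
  0 < a < l.+1%:R -> injective s -> (forall k, ~ negreals R (s k)) ->
  ~ negreals R z ->
  cpow z a = (sin (a * pi) / ((-1) ^+ l * pi))%:C *
      cintegral (fun y => (y `^ (a - 1))%:C * kernel_factor s z y)
    + z * lagrange_interp (fun w => cpow w (a - 1)) s z.
Proof.
move=> /andP[a0 al] sI sN zN; have z0 := slit_neq0 zN.
pose n := Num.truncn a.
have /andP[na an] : n%:R <= a < n.+1%:R by apply: Num.Theory.truncn_itv; exact: ltW.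
have nl : (n <= l)%N by rewrite -ltnS -(ltr_nat R); exact: le_lt_trans al.
pose b := a - n%:R; have aE : a = n%:R + b by rewrite /b; ring.
have L1 : z * cpow z (a - 1) = cpow z a.
  by rewrite -{1}(cpow1 z0) -cpowD// addrC subrK.
have [b0|b0] := eqVneq b 0.
  have an' : a = n%:R by rewrite aE b0 addr0.
  have n0 : (0 < n)%N by rewrite -(ltr_nat R) -an'.
  have -> : sin (a * pi) = 0 by rewrite aE sin_natD_pi b0 mul0r sin0 mulr0.
  rewrite mul0r rmorph0 mul0r add0r -L1; congr (_ * _).
  have pw (w : R[i]) : w != 0 -> cpow w (a - 1) = ('X^(n.-1) : {poly R[i]}).[w].
    move=> w0; rewrite hornerXn -cpow_nat// an'; congr cpow.
    by rewrite -{1}(prednK n0) -natr1 addrK.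
  rewrite pw// -(lagrange_exact _ sI); last by rewrite size_polyXn prednK.
  by apply: eq_bigr => i _; rewrite pw//; exact: slit_neq0.
have b01 : 0 < b < 1.
  by rewrite lt_neqAle eq_sym b0 /b subr_ge0 na/= ltrBlDl natr1.
have /andP[b_gt0 b_lt1] := b01.
have sb0 : sin (b * pi) != 0.
  by rewrite gt_eqF// sin_gt0_pi// mulr_gt0 ?pi_gt0//= gtr_pMl// pi_gt0.
pose G (w : R[i]) (y : R) : R[i] := (y `^ (b - 1))%:C * (y%:C + w)^-1.
have Gi w : ~ negreals R w -> cintegrable (G w).
  by move=> wN; have [] := stieltjes_transform b01 wN.
have GI w : ~ negreals R w ->
    cintegral (G w) = (pi / sin (b * pi))%:C * cpow w (b - 1).
  by move=> wN; have [] := stieltjes_transform b01 wN.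
have -> : cintegral (fun y => (y `^ (a - 1))%:C * kernel_factor s z y) =
    cintegral (fun y => (-1) ^+ l * z * ((- z) ^+ n * G z y +
    \sum_i (- ((- s i) ^+ n * lagrange_coef s z i)) * G (s i) y)).
  by apply: eq_cintegral => y y0; rewrite aE; exact: kernel_factor_expand.
have [Si SI] := @cintegrable_sum R 'I_l
  (fun i y => (- ((- s i) ^+ n * lagrange_coef s z i)) * G (s i) y)
  (fun i => cintegrableZ _ (Gi _ (sN i))).
have zi := cintegrableZ ((- z) ^+ n) (Gi _ zN).
rewrite cintegralZ; last exact: cintegrableD.
rewrite cintegralD// SI cintegralZ; last exact: Gi.
rewrite GI//.
pose c : R[i] := (pi / sin (b * pi))%:C.
have cpwn w : ~ negreals R w ->
    (- w) ^+ n * cpow w (b - 1) = (-1) ^+ n * cpow w (a - 1).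
  move=> wN; have w0 := slit_neq0 wN.
  by rewrite (exprNn w) -mulrA -(cpow_nat n w0) -cpowD// aE addrA.
have -> : \sum_i cintegral (fun y => - ((- s i) ^+ n * lagrange_coef s z i) * G (s i) y)
    = - c * (-1) ^+ n * lagrange_interp (fun w => cpow w (a - 1)) s z.
  rewrite /lagrange_interp big_distrr/=; apply: eq_bigr => i _.
  rewrite cintegralZ ?GI//; last exact: Gi.
  rewrite -/(lagrange_coef s z i) -/c.
  have := cpwn _ (sN i) => E.
  transitivity (- c * lagrange_coef s z i * ((- s i) ^+ n * cpow (s i) (b - 1))).
    by ring.
  by rewrite E; ring.
set L := lagrange_interp _ _ _.
have -> : (- z) ^+ n * ((pi / sin (b * pi))%:C * cpow z (b - 1)) =
    c * ((-1) ^+ n * cpow z (a - 1)) by rewrite mulrCA cpwn.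
rewrite -[in LHS]L1.
have -> : sin (a * pi) / ((-1) ^+ l * pi) =
    (-1) ^+ l * ((-1) ^+ n * (sin (b * pi) / pi)).
  rewrite {1}aE sin_natD_pi invfM -exprVn invrN1; ring.
have sgn k : (-1) ^+ k * (-1) ^+ k = 1 :> R[i].
  by rewrite -exprMn mulN1r opprK expr1n.
have cc : (sin (b * pi) / pi)%:C * c = 1.
  rewrite /c -rmorphM/= [X in X%:C](_ : _ = 1)//.
  by rewrite mulrA divfK ?divff// gt_eqF// pi_gt0.
rewrite !rmorphM/= !rmorphXn/= !rmorphN1.
transitivity ((((-1) ^+ l * (-1) ^+ l) * ((-1) ^+ n * (-1) ^+ n) *
   ((sin (b * pi) / pi)%:C * c)) * z * (cpow z (a - 1) - L) + z * L).
  by rewrite !sgn cc; ring.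
ring.
Qed.

(** Turns the hypothesis on the integer part into the open range of exponents on
    which [interp_formula] is differentiated. *)
Lemma lt_floorS (R : realType) (a : R) (l : nat) :
  Num.floor a <= l%:Z -> a < l.+1%:R.
Proof.
by move=> h; rewrite -[ltRHS]/(l.+1%:Z%:~R) -floor_lt_int -addn1 PoszD ltzD1.
Qed.

(** Both sides of [interp_formula] are differentiated in [a]. The set of admissible
    exponents is open, so the derivatives can be compared at each of them,
    integers included. *)
Lemma interp_log_formula (R : realType) (a : R) (l : nat) (s : 'I_l -> R[i])
    (z : R[i]) :
  0 < a < l.+1%:R -> injective s -> (forall k, ~ negreals R (s k)) ->
  ~ negreals R z ->
  cpow z a * clog z = (sin (a * pi) / ((-1) ^+ l * pi))%:C *
      cintegral (fun y => (y `^ (a - 1) * ln y)%:C * kernel_factor s z y)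
    + (cos (a * pi) / (-1) ^+ l)%:C *
      cintegral (fun y => (y `^ (a - 1))%:C * kernel_factor s z y)
    + z * lagrange_interp (fun w => cpow w (a - 1) * clog w) s z.
Proof.
move=> al sI sN zN; have z0 := slit_neq0 zN.
have [_ _ dI] := Mellin_decays (decays_kernel_factor sN zN) al.
have ain : a \in `]0, l.+1%:R[ by rewrite in_itv.
have pi0 : (pi : R) != 0 by rewrite gt_eqF// pi_gt0.
have dsin : is_derive a 1 (fun t => sin (t * pi) / ((-1) ^+ l * pi))
    (cos (a * pi) / (-1) ^+ l).
  derive; rewrite /= mulr0 addr0 mul1r mulr0 addr0 invfM mulrA mulrAC.
  by rewrite mulfK.
have dL : is_cderive a (fun t => lagrange_interp (fun w => cpow w (t - 1)) s z)
    (lagrange_interp (fun w => cpow w (a - 1) * clog w) s z).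
  apply: is_cderive_sum => i.
  have := is_cderiveMl (lagrange_coef s z i)
    (is_cderive_cpow a (-1) (slit_neq0 (sN i))).
  rewrite [X in is_cderive _ _ X]mulrC.
  by under eq_fun do rewrite mulrC.
have dR := is_cderiveD (is_cderiveM (is_cderive_real dsin) dI) (is_cderiveMl z dL).
have dz := is_cderive_cpow a 0 z0; rewrite addr0 in dz.
rewrite (is_cderive_unique ain _ dz dR).
  by rewrite [X in X + _]addrC.
by move=> t; rewrite in_itv/= addr0 => tl; exact: interp_formula.
Qed.

Theorem theorem2p1 (R : realType) :
  (forall (a : R) (l : nat) (s : 'I_l -> R[i]),
     0 < a ->
     Num.floor a <= l%:Z ->
     injective s ->
     (forall k, ~ [set x%:C | x in `]-oo, (0 : R)]] (s k)) ->
     forall z : R[i], ~ [set x%:C | x in `]-oo, (0 : R)[] z ->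
       [/\ cintegrable (fun y => pow_kernel a z y * node_prod s z y),
           cintegrable (fun y => log_kernel a z y * node_prod s z y),
           cpow z a =
             (sin (a * pi) / ((-1) ^+ l * pi))%:C *
               cintegral (fun y => pow_kernel a z y * node_prod s z y)
             + z * lagrange_interp (fun w => cpow w (a - 1)) s z
         & cpow z a * clog z =
             (sin (a * pi) / ((-1) ^+ l * pi))%:C *
               cintegral (fun y => log_kernel a z y * node_prod s z y)
             + (cos (a * pi) / (-1) ^+ l)%:C *
               cintegral (fun y => pow_kernel a z y * node_prod s z y)
             + z * lagrange_interp (fun w => cpow w (a - 1) * clog w) s z])
  /\
  (forall a : R, 0 < a < 1 ->
     forall z : R[i], ~ [set x%:C | x in `]-oo, (0 : R)[] z ->
       [/\ cintegrable (pow_kernel a z),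
           cintegrable (log_kernel a z),
           cpow z a = (sin (a * pi) / pi)%:C * cintegral (pow_kernel a z)
         & cpow z a * clog z =
             (sin (a * pi) / pi)%:C * cintegral (log_kernel a z)
             + (cos (a * pi))%:C * cintegral (pow_kernel a z)]).
Proof.
have H (a : R) (l : nat) (s : 'I_l -> R[i]) :
     0 < a < l.+1%:R -> injective s ->
     (forall k, ~ [set x%:C | x in `]-oo, (0 : R)]] (s k)) ->
     forall z : R[i], ~ [set x%:C | x in `]-oo, (0 : R)[] z ->
       [/\ cintegrable (fun y => pow_kernel a z y * node_prod s z y),
           cintegrable (fun y => log_kernel a z y * node_prod s z y),
           cpow z a =
             (sin (a * pi) / ((-1) ^+ l * pi))%:C *
               cintegral (fun y => pow_kernel a z y * node_prod s z y)
             + z * lagrange_interp (fun w => cpow w (a - 1)) s z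
         & cpow z a * clog z =
             (sin (a * pi) / ((-1) ^+ l * pi))%:C *
               cintegral (fun y => log_kernel a z y * node_prod s z y)
             + (cos (a * pi) / (-1) ^+ l)%:C *
               cintegral (fun y => pow_kernel a z y * node_prod s z y)
             + z * lagrange_interp (fun w => cpow w (a - 1) * clog w) s z].
  move=> al sI sN z zN.
  have pE := funext (pow_kernelE s z a); have lE := funext (log_kernelE s z a).
  rewrite pE lE.
  (* At the origin every term carries the factor z; any other admissible z lies
     outside the closed half-line. *)
  have [z0|z0] := eqVneq z 0.
    have k0 : kernel_factor s z = fun=> 0.
      by apply/funext => y; rewrite /kernel_factor z0 !mul0r.
    have pk0 : (fun y => (y `^ (a - 1))%:C * kernel_factor s z y) = fun=> 0.
      by apply/funext => y; rewrite k0 mulr0.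
    have lk0 : (fun y => (y `^ (a - 1) * ln y)%:C * kernel_factor s z y) = fun=> 0.
      by apply/funext => y; rewrite k0 mulr0.
    rewrite pk0 lk0 cintegral0 /cpow z0 eqxx !mul0r !mulr0 !addr0.
    by split => //; exact: cintegrable0.
  have zN' : ~ [set x%:C | x in `]-oo, (0 : R)]] z.
    move=> [x /= x0 xz]; apply: zN; exists x => //=; move: x0.
    rewrite !in_itv/= le_eqVlt => /orP[/eqP x0|//].
    by move: z0; rewrite -xz x0 eqxx.
  have [i1 i2 _] := Mellin_decays (decays_kernel_factor sN zN') al.
  by split => //; [exact: interp_formula|exact: interp_log_formula].
split=> [a l s a0 al sI sN z zN|a a01 z zN].
  by apply: H => //; rewrite a0/= lt_floorS.
(* the case of no nodes, where the product is 1 and the interpolant is 0 *)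
pose s (i : 'I_0) : R[i] := 0.
have s0 (k : 'I_0) : False by case: k.
have sI : injective s by move=> k; case: (s0 k).
have sN k : ~ [set x%:C | x in `]-oo, (0 : R)]] (s k) by case: (s0 k).
have [i1 i2 e1 e2] := @H a 0%N s a01 sI sN z zN.
have np y : node_prod s z y = 1 by rewrite /node_prod big_ord0.
have L0 X : lagrange_interp X s z = 0 by rewrite /lagrange_interp big_ord0.
have pE : (fun y => pow_kernel a z y * node_prod s z y) = pow_kernel a z.
  by apply/funext => y; rewrite np mulr1.
have lE : (fun y => log_kernel a z y * node_prod s z y) = log_kernel a z.
  by apply/funext => y; rewrite np mulr1.
rewrite pE in i1 e1 e2; rewrite lE in i2 e2.
rewrite L0 mulr0 addr0 expr0 mul1r in e1.
by rewrite L0 mulr0 addr0 expr0 mul1r divr1 in e2.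
Qed.
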